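(* Let $K$ be a field, let $\mathcal{M}$ be a monoidal complex supported on a conical complex $\Sigma$, let $(a_e)_{e\in E}$ be a (finite) family of elements of $|\mathcal{M}|$ such that $\{a_e:e\in E\}\cap M_c$ generates $M_c$ for each $c\in\Sigma$, and let $w=(w_e)_{e\in E}$ be a weight vector. Then the following statements are equivalent: (i) $\operatorname{in}_w(I_{\mathcal{M}})$ is a radical ideal; (ii) for all facets $d\in\Gamma_w$ one has $N_{d,w}=M_c\cap D_d$, where $c\in\Sigma$ is the smallest face such that $d\subseteq c$.
   Context: A cone is a set $\mathbb{R}_+x_1+\dots+\mathbb{R}_+x_n\subseteq\mathbb{R}^d$. Its faces are $C$ itself and the sets $C\cap H$ with $H$ a linear hyperplane having $C$ in one of its closed halfspaces. An isomorphism of cones is a bijection extending to an isomorphism of their linear spans. A conical complex $\Sigma$ consists of a finite set $\Sigma$ of sets, for each $c\in\Sigma$ a cone $C_c\subseteq\mathbb{R}^{\delta_c}$ with $\delta_c=\dim\mathbb{R}C_c$, and a bijection $\pi_c:C_c\to c$ such that: (a) for each face $C'$ of $C_c$ there is $c'\in\Sigma$ with $\pi_c(C')=c'$; (b) for all $c,d\in\Sigma$ there are faces $C'$ of $C_c$ and $D'$ of $C_d$ with $c\cap d=\pi_c(C')=\pi_d(D')$ such that $\pi_d^{-1}\circ\pi_c$ restricts to an isomorphism of cones $C'\to D'$. The elements of $\Sigma$ are its faces, the maximal ones its facets; $|\Sigma|=\bigcup_{c\in\Sigma}c$, and $C_c$ is identified with $c\subseteq|\Sigma|$. A monoidal complex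 $\mathcal{M}=(M_c)_{c\in\Sigma}$ supported by $\Sigma$ consists of finitely generated monoids $M_c\subseteq C_c\cap\mathbb{Z}^{\delta_c}$ with $\mathbb{R}_+M_c=C_c$ such that $\pi_d^{-1}\circ\pi_c$ restricts to a monoid isomorphism $M_c\cap\pi_c^{-1}(c\cap d)\to M_d\cap\pi_d^{-1}(c\cap d)$ for all $c,d\in\Sigma$. Put $|\mathcal{M}|=\varinjlim M_c$ (the union of the $M_c$ inside $|\Sigma|$). The toric face ring $K[\mathcal{M}]$ has $K$-basis $t^a$, $a\in|\mathcal{M}|$, with $t^at^b=t^{a+b}$ if $a,b\in M_c$ for some $c\in\Sigma$, and $t^at^b=0$ otherwise. Let $S=K[X_e:e\in E]$ and let $I_{\mathcal{M}}$ be the kernel of $S\to K[\mathcal{M}]$, $X_e\mapsto t^{a_e}$. A weight vector is $w\in\mathbb{N}^E$ ($\mathbb{N}$ the non-negative integers); $X_e$ gets weight $w_e$. The initial component $\operatorname{in}_w(f)$ is the $w$-homogeneous component of $f$ of highest $w$-degree, and $\operatorname{in}_w(I)$ is the ideal generated by all $\operatorname{in}_w(f)$, $f\in I$. Complex $\Gamma_w$: for $c\in\Sigma$ let $C'_c\subseteq\mathbb{R}^{\delta_c+1}$ be the cone generated by all $(a_e,w_e)$ with $a_e\in C_c$. For $a\in|\Sigma|$ let $c$ be the minimal face of $\Sigma$ containing $a$ and put $\operatorname{ht}_w(a)=\min\{h'\in\mathbb{R}:(a,h')\in C'_c\}$. The bottom of $C'_c$ is the set of $(a,h_a)\in C'_c$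 with $h_a=\min\{h':(a,h')\in C'_c\}$; it is a union of faces of $C'_c$. The projections to $C_c$ of the faces of $C'_c$ contained in the bottom form a conical subdivision of $C_c$, and together, for all $c\in\Sigma$, these form a conical complex $\Gamma_w$ with $|\Gamma_w|=|\Sigma|$. Write $D_d$ for the cone of $d\in\Gamma_w$. For $d\in\Gamma_w$, $N_{d,w}$ is the monoid generated by all $a_e\in D_d$ with $\operatorname{ht}_w(a_e)=w_e$. *)

(* Defs.v *)
From HB Require Import structures.
From mathcomp Require Import all_boot all_order all_algebra.
From mathcomp Require Import mathcomp_extra boolp classical_sets functions reals.
From mathcomp.multinomials Require Import freeg mpoly.

Set Implicit Arguments.
Unset Strict Implicit.
Unset Printing Implicit Defensive.

Import Order.TTheory GRing.Theory Num.Theory.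

Local Open Scope classical_set_scope.
Local Open Scope ring_scope.

Section Hulls.

Definition combinations (R : nzRingType) (V : lmodType R) (A : set R)
    (G : set V) : set V :=
  [set x | exists (k : nat) (l : 'I_k -> R) (v : 'I_k -> V),
     [/\ forall i, A (l i), forall i, G (v i) & x = \sum_i l i *: v i]].

Definition lspan (R : nzRingType) (V : lmodType R) (G : set V) : set V :=
  combinations setT G.

Definition cone_hull (R : numDomainType) (V : lmodType R) (G : set V) : set V :=
  combinations [set r : R | 0 <= r] G.

Definition monoid_hull (V : nmodType) (G : set V) : set V :=
  [set x | exists (k : nat) (v : 'I_k -> V),
     (forall i, G (v i)) /\ x = \sum_i v i].

Definition ideal_hull (A : comNzRingType) (G : set A) : set A :=
  [set x | exists (k : nat) (l v : 'I_k -> A),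
     (forall i, G (v i)) /\ x = \sum_i l i * v i].

End Hulls.

Section Cones.
Variable R : realType.

Definition is_cone d (C : set 'rV[R]_d) : Prop :=
  exists s : seq 'rV[R]_d, C = cone_hull [set` s].

Definition has_dim d (C : set 'rV[R]_d) (k : nat) : Prop :=
  exists2 V : {vspace 'rV[R]_d}, lspan C = [set x | x \in V] & \dim V = k.

(* The column [l] is the linear form cutting out the hyperplane. *)
Definition is_face d (C F : set 'rV[R]_d) : Prop :=
  F = C \/
  exists l : 'cV[R]_d,
    [/\ l != 0,
        (forall x, C x -> 0 <= (x *m l) 0 0)
      & F = C `&` [set x | (x *m l) 0 0 = 0]].

(* A linear map between the spans is the restriction of one between the
   ambient spaces. *)
Definition cone_iso m n (C : set 'rV[R]_m) (D : set 'rV[R]_n)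
    (f : 'rV[R]_m -> 'rV[R]_n) : Prop :=
  set_bij C D f /\
  exists L : {linear 'rV[R]_m -> 'rV[R]_n},
    set_bij (lspan C) (lspan D) L /\ {in C, f =1 L}.

Definition monoid_iso (U V : nmodType) (A : set U) (B : set V) (f : U -> V) :
    Prop :=
  [/\ set_bij A B f, f 0 = 0 & {in A &, {morph f : x y / x + y}}].

End Cones.

(* The faces of the complex are the subsets [pts c] of [X], indexed without
   repetition by a finite type; [chart c] plays the role of pi_c and is only
   meaningful on [cone c]. *)
Section Complexes.
Variables (R : realType) (X : choiceType).

Definition chart_change (d1 d2 : nat) (C2 : set 'rV[R]_d2)
    (p1 : 'rV[R]_d1 -> X) (p2 : 'rV[R]_d2 -> X) : 'rV[R]_d1 -> 'rV[R]_d2 :=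
  pinv_ (fun=> 0) C2 p2 \o p1.

Record conicalComplex := ConicalComplex {
  face : finType;
  pts : face -> set X;
  delta : face -> nat;
  cone : forall c, set 'rV[R]_(delta c);
  chart : forall c, 'rV[R]_(delta c) -> X;
  pts_inj : injective pts;
  coneP : forall c, is_cone (@cone c);
  cone_dim : forall c, has_dim (@cone c) (delta c);
  chart_bij : forall c, set_bij (@cone c) (pts c) (@chart c);
  face_closed : forall c F, is_face (@cone c) F ->
    exists c', @chart c @` F = pts c';
  face_glue : forall c d, exists F G,
    [/\ is_face (@cone c) F,
        is_face (@cone d) G,
        pts c `&` pts d = @chart c @` F,
        pts c `&` pts d = @chart d @` G
      & cone_iso F G (chart_change (@cone d) (@chart c) (@chart d))]
}.

Arguments chart {_} c _.
Arguments cone {_} c _.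
Arguments pts {_} c _.

Definition transition (S : conicalComplex) (c d : face S) :=
  chart_change (cone d) (chart c) (chart d).

Arguments transition {S} c d _.

Definition smallest_face (S : conicalComplex) (A : set X) (c : face S) : Prop :=
  A `<=` pts c /\ forall c' : face S, A `<=` pts c' -> pts c `<=` pts c'.

Record monoidalComplex (S : conicalComplex) := MonoidalComplex {
  mon : forall c : face S, set 'rV[R]_(delta c);
  mon_fg : forall c, exists s : seq 'rV[R]_(delta c),
    @mon c = monoid_hull [set` s];
  mon_sub : forall c, @mon c `<=`
    cone c `&` [set u | u \is a @mxOver _ _ R Num.int];
  mon_cone : forall c, cone_hull (@mon c) = cone c;
  mon_glue : forall c d,
    monoid_iso (@mon c `&` chart c @^-1` (pts c `&` pts d))
               (@mon d `&` chart d @^-1` (pts c `&` pts d))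
               (transition c d)
}.

Definition monsupp (S : conicalComplex) (M : monoidalComplex S) : set X :=
  \bigcup_(c : face S) (chart c @` @mon S M c).

End Complexes.

Arguments chart {R X _} c _.
Arguments cone {R X _} c _.
Arguments pts {R X _} c _.
Arguments mon {R X S} m c _.
Arguments transition {R X S} c d _.

Section PartialAddition.
Variables (R : realType) (X : choiceType).

Lemma cone_hull0 (V : lmodType R) (G : set V) : cone_hull G 0.
Proof.
exists 0%N, (fun=> 0), (fun=> 0).
by split=> [[]//|[]//|]; rewrite big_ord0.
Qed.

Lemma monoid_hull0 (V : nmodType) (G : set V) : monoid_hull G 0.
Proof. by exists 0%N, (fun=> 0); split=> [[]//|]; rewrite big_ord0. Qed.

Lemma monoid_hullD (V : nmodType) (G : set V) x y :
  monoid_hull G x -> monoid_hull G y -> monoid_hull G (x + y).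
Proof.
move=> [k [v [Gv ->]]] [l [u [Gu ->]]].
exists (k + l)%N,
  (fun i => match fintype.split i with inl j => v j | inr j => u j end).
split=> [i|]; first by case: (fintype.split i).
rewrite big_split_ord; congr (_ + _); apply: eq_bigr => i _.
  by rewrite (unsplitK (inl i : 'I_k + 'I_l)).
by rewrite (unsplitK (inr i : 'I_k + 'I_l)).
Qed.

Lemma face_sub d (C F : set 'rV[R]_d) : is_face C F -> F `<=` C.
Proof. by case=> [->//|[l [_ _ ->]] x []]. Qed.

Lemma face0 d (C F : set 'rV[R]_d) : is_face C F -> C 0 -> F 0.
Proof.
by case=> [->//|[l [_ _ ->]]] C0; split=> //=; rewrite mul0mx mxE.
Qed.

Lemma faceD d (C F : set 'rV[R]_d) u v : is_face C F ->
  C u -> C v -> C (u + v) -> F (u + v) <-> F u /\ F v.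
Proof.
case=> [-> //|[l [_ Cl ->]]] Cu Cv Cuv; rewrite /= mulmxDl mxE.
have /Cl u0 := Cu; have /Cl v0 := Cv; split=> [[_ /eqP]|[[_ ->] [_ ->]]].
  by rewrite paddr_eq0// => /andP[/eqP -> /eqP ->].
by rewrite addr0.
Qed.

Variables (S : conicalComplex R X) (M : monoidalComplex S).
Implicit Types (c d : face S) (x y z : X).

Lemma monD c u v : mon M c u -> mon M c v -> mon M c (u + v).
Proof. by have [s ->] := mon_fg M c; apply: monoid_hullD. Qed.

Lemma mon0 c : mon M c 0.
Proof. by have [s ->] := mon_fg M c; apply: monoid_hull0. Qed.

Lemma mon_in_cone c u : mon M c u -> cone c u.
Proof. by case/(@mon_sub _ _ _ M). Qed.

Lemma chart_pts c u : cone c u -> pts c (chart c u).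
Proof. by have [H _ _] := chart_bij c; apply: H. Qed.

Lemma chart_inj c u v : cone c u -> cone c v -> chart c u = chart c v -> u = v.
Proof. by have [_ H _] := chart_bij c => Cu Cv; apply: H; apply/mem_set. Qed.

Lemma transitionE c d u v : cone d v -> chart c u = chart d v ->
  transition c d u = v.
Proof.
move=> Cv E; rewrite /transition /chart_change /= E pinvKV//.
  by move=> s t /set_mem Cs /set_mem Ct; apply: chart_inj.
exact/mem_set.
Qed.

Lemma chart_transition c d u : cone c u -> pts d (chart c u) ->
  chart d (transition c d u) = chart c u.
Proof.
have [_ _ sd] := chart_bij d => Cu /sd[v Cv E].
by rewrite (transitionE Cv) ?E.
Qed.

Lemma pts_chartD c d u v : mon M c u -> mon M c v ->
  pts d (chart c (u + v)) <-> pts d (chart c u) /\ pts d (chart c v).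
Proof.
move=> Mu Mv; have Muv := monD Mu Mv.
have [F [G [fF _ E _ _]]] := face_glue c d.
have key (s : 'rV[R]_(delta c)) : mon M c s -> pts d (chart c s) <-> F s.
  move=> Ms; have Cs := mon_in_cone Ms; split=> [ds|Fs].
    have : (pts c `&` pts d) (chart c s) by split=> //; exact: chart_pts.
    rewrite E => -[t Ft Et].
    by rewrite -(chart_inj (face_sub fF Ft) Cs Et).
  by have [_] : (pts c `&` pts d) (chart c s) by rewrite E; exists s.
have h := faceD fF (mon_in_cone Mu) (mon_in_cone Mv) (mon_in_cone Muv).
by rewrite !key.
Qed.

Lemma mon_transition c d u : mon M c u -> pts d (chart c u) ->
  mon M d (transition c d u).
Proof.
move=> Mu du; have [[tf _ _] _ _] := mon_glue M c d.
have [] // := tf u; split=> //=; split=> //.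
exact/chart_pts/mon_in_cone.
Qed.

Lemma transitionD c d u v : mon M c u -> mon M c v ->
  pts d (chart c u) -> pts d (chart c v) ->
  transition c d (u + v) = transition c d u + transition c d v.
Proof.
move=> Mu Mv du dv; have [_ _ ->//] := mon_glue M c d.
  apply/mem_set; split=> //=; split=> //; exact/chart_pts/mon_in_cone.
apply/mem_set; split=> //=; split=> //; exact/chart_pts/mon_in_cone.
Qed.

Definition is_sum x y z : Prop :=
  exists (c : face S) (u v : 'rV[R]_(delta c)),
    [/\ mon M c u, mon M c v, chart c u = x, chart c v = y
      & chart c (u + v) = z].

Lemma is_sum_at d x y z w : is_sum x y z -> mon M d w -> chart d w = z ->
  exists u v, [/\ mon M d u, mon M d v, chart d u = x, chart d v = y
                & u + v = w].
Proof.
move=> [c [u [v [Mu Mv Eu Ev Euv]]]] Mw Ew.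
have duv : pts d (chart c (u + v)).
  by rewrite Euv -Ew; exact/chart_pts/mon_in_cone.
have /(pts_chartD d Mu Mv)[du dv] := duv.
exists (transition c d u), (transition c d v); split.
- exact: mon_transition.
- exact: mon_transition.
- by rewrite chart_transition//; exact: mon_in_cone.
- by rewrite chart_transition//; exact: mon_in_cone.
- by rewrite -transitionD//; apply: transitionE; rewrite ?Euv//;
    exact: mon_in_cone.
Qed.

Lemma is_sum_uniq x y z z' : is_sum x y z -> is_sum x y z' -> z = z'.
Proof.
move=> [c [u [v [Mu Mv Eu Ev Euv]]]] [d [u' [v' [Mu' Mv' Eu' Ev' Euv']]]].
have Cu' := mon_in_cone Mu'; have Cv' := mon_in_cone Mv'.
have du : pts d (chart c u) by rewrite Eu -Eu'; exact: chart_pts.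
have dv : pts d (chart c v) by rewrite Ev -Ev'; exact: chart_pts.
have duv : pts d (chart c (u + v)) by apply/(pts_chartD d Mu Mv).
rewrite -Euv -Euv' -(chart_transition (mon_in_cone (monD Mu Mv)) duv).
rewrite transitionD// (transitionE Cu') ?Eu//.
by rewrite (transitionE Cv') ?Ev.
Qed.

Lemma is_sumC x y z : is_sum x y z -> is_sum y x z.
Proof. by move=> [c [u [v [*]]]]; exists c, v, u; split; rewrite // addrC. Qed.

Lemma is_sumA x y s z t : is_sum x y s -> is_sum s z t ->
  exists2 r, is_sum y z r & is_sum x r t.
Proof.
move=> xys [d [w [k [Mw Mk Ew Ek Ewk]]]].
have [u [v [Mu Mv Eu Ev E]]] := is_sum_at xys Mw Ew.
exists (chart d (v + k)); first by exists d, v, k.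
by exists d, u, (v + k); split=> //; [exact: monD | rewrite addrA E].
Qed.

Lemma is_sum_supp x y z : is_sum x y z -> monsupp M z.
Proof.
move=> [c [u [v [Mu Mv _ _ <-]]]]; exists c => //; exists (u + v) => //.
exact: monD.
Qed.

Lemma chart0 c d : chart c 0 = chart d 0.
Proof.
have [F [G [fF _ E _ _]]] := face_glue c d.
have F0 : F 0 by apply: (face0 fF); exact: mon_in_cone (@mon0 c).
have [_ dc] : (pts c `&` pts d) (chart c 0) by rewrite E; exists 0.
have [_ t0 _] := mon_glue M c d.
by rewrite -(chart_transition (mon_in_cone (@mon0 c)) dc) t0.
Qed.

End PartialAddition.

(* The free K-module on |M|: the basis vector t^x is [<< x >>]. *)
Definition toricRing (K : fieldType) (R : realType) (X : choiceType)
    (S : conicalComplex R X) (M : monoidalComplex S) : Type :=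
  {freeg (monsupp M) / K}.

Section ToricRing.
Variables (K : fieldType) (R : realType) (X : choiceType).
Variables (S : conicalComplex R X) (M : monoidalComplex S).

Local Notation A := (toricRing K M).

HB.instance Definition _ := GRing.Lmodule.on A.

Implicit Types (x y z : monsupp M) (f g h : A).

Definition tmon x : A := << x >>.

Definition tmul_basis x y : A :=
  match pselect (exists z : monsupp M, is_sum M (val x) (val y) (val z)) with
  | left H => tmon (projT1 (cid H))
  | right _ => 0
  end.

(* The K-bilinear extension of [tmul_basis]. *)
Definition tmul f g : A := fglift (fun x => fglift (tmul_basis x) g : A) f.

Fact monsupp0 (c : face S) : chart c 0 \in monsupp M.
Proof. by apply/mem_set; exists c => //; exists 0 => //; exact: mon0. Qed.

(* If the complex has no faces, the ring is zero. *)
Definition tone : A :=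
  if [pick c : face S] is Some c then tmon (SigSub (monsupp0 c)) else 0.

Lemma toric_ind (P : A -> Prop) :
  (forall x, P (tmon x)) -> P 0 ->
  (forall k f g, P f -> P g -> P (k *: f + g)) -> forall f, P f.
Proof.
move=> Pm P0 PD f; rewrite -[f]freeg_sumE.
have PZ k x : P << k *g x >>.
  suff -> : << k *g x >> = k *: tmon x + 0 :> A by apply: PD.
  apply/eqP/freeg_eqP => y.
  by rewrite addr0 coeffZ !coeffU mul1r.
elim/big_ind: _ => // g h Pg Ph.
by rewrite -[g]scale1r; apply: PD.
Qed.

Lemma fglift_is_linear (V : lmodType K) (F : monsupp M -> V) :
  linear (fglift F : A -> V).
Proof.
pose L : {additive _ -> V} := HB.pack (fglift F)
  (GRing.isZmodMorphism.Build _ _ _ (@lift_is_additive K _ V F)).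
move=> k f g; rewrite -[fglift F]/(L : _ -> _) raddfD; congr (_ + _).
have -> : L f = \sum_(x <- dom f) coeff x f *: F x.
  rewrite -{1}[f]freeg_sumE raddf_sum; apply: eq_bigr => x _.
  exact: liftU.
have -> : k *: f = \sum_(x <- dom f) << k * coeff x f *g x >> :> A by [].
rewrite raddf_sum scaler_sumr; apply: eq_bigr => x _.
by rewrite scalerA; apply: liftU.
Qed.

Lemma fgliftU1 (V : lmodType K) (F : monsupp M -> V) x : fglift F (tmon x) = F x.
Proof. by rewrite liftU scale1r. Qed.

Lemma tmulPl k f g h : tmul (k *: f + g) h = k *: tmul f h + tmul g h.
Proof. exact: fglift_is_linear. Qed.

Lemma tmul0l h : tmul 0 h = 0.
Proof. by have := tmulPl (-1) 0 0 h; rewrite scaler0 add0r scaleN1r addNr. Qed.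

Lemma tmulPr k f g h : tmul h (k *: f + g) = k *: tmul h f + tmul h g.
Proof.
elim/toric_ind: h => [x||l h1 h2 E1 E2].
- by rewrite /tmul !fgliftU1 fglift_is_linear.
- by rewrite !tmul0l scaler0 addr0.
- rewrite !tmulPl E1 E2 !scalerDr !scalerA [k * l]mulrC -!addrA.
  by congr (_ + _); rewrite addrCA.
Qed.

Lemma tmul0r h : tmul h 0 = 0.
Proof. by have := tmulPr (-1) 0 0 h; rewrite scaler0 add0r scaleN1r addNr. Qed.

Lemma tmulU x y : tmul (tmon x) (tmon y) = tmul_basis x y.
Proof. by rewrite /tmul !fgliftU1. Qed.

Lemma tmul_tmon x y z : is_sum M (val x) (val y) (val z) ->
  tmul (tmon x) (tmon y) = tmon z.
Proof.
move=> H; rewrite tmulU /tmul_basis; case: pselect => [E|[]]; last by exists z.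
by congr tmon; apply: val_inj; exact: is_sum_uniq (projT2 (cid E)) H.
Qed.

Lemma tmul_tmon0 x y : (forall z : X, ~ is_sum M (val x) (val y) z) ->
  tmul (tmon x) (tmon y) = 0.
Proof.
move=> H; rewrite tmulU /tmul_basis; case: pselect => // -[z Hz].
by case: (H _ Hz).
Qed.

Variant tmul_spec x y : A -> Prop :=
| TmulSum z of is_sum M (val x) (val y) (val z) : tmul_spec x y (tmon z)
| TmulNone of (forall z : X, ~ is_sum M (val x) (val y) z) : tmul_spec x y 0.

Lemma tmulP x y : tmul_spec x y (tmul (tmon x) (tmon y)).
Proof.
case: (pselect (exists z : X, is_sum M (val x) (val y) z)) => [[z H]|H].
  have Mz : z \in monsupp M by apply/mem_set/(is_sum_supp H).
  by rewrite (@tmul_tmon _ _ (SigSub Mz))//; apply: TmulSum.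
have {}H (z : X) : ~ is_sum M (val x) (val y) z by move=> ?; apply: H; exists z.
by rewrite tmul_tmon0//; apply: TmulNone.
Qed.

Lemma tmulC : commutative tmul.
Proof.
move=> f g; elim/toric_ind: f => [x||k f1 f2 E1 E2].
- elim/toric_ind: g => [y||k g1 g2 E1 E2].
  + case: (tmulP y x) => [z /is_sumC|H]; first exact: tmul_tmon.
    by apply: tmul_tmon0 => z /is_sumC/H.
  + by rewrite tmul0l tmul0r.
  + by rewrite tmulPl tmulPr E1 E2.
- by rewrite tmul0l tmul0r.
- by rewrite tmulPl tmulPr E1 E2.
Qed.

Lemma tmulA : associative tmul.
Proof.
move=> f g h; elim/toric_ind: f => [x||k f1 f2 E1 E2]; last 2 first.
- by rewrite !tmul0l.
- by rewrite !tmulPl E1 E2.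
elim/toric_ind: g => [y||k g1 g2 E1 E2]; last 2 first.
- by rewrite tmul0r !tmul0l tmul0r.
- by rewrite tmulPr !tmulPl tmulPr E1 E2.
elim/toric_ind: h => [z||k h1 h2 E1 E2]; last 2 first.
- by rewrite !tmul0r.
- by rewrite !tmulPr E1 E2.
case: (tmulP y z) => [r yzr|nyz].
  case: (tmulP x r) => [t xrt|nxr].
    have [s] := is_sumA (is_sumC yzr) (is_sumC xrt).
    move=> /is_sumC xys /is_sumC szt.
    have Ms : s \in monsupp M by apply/mem_set/(is_sum_supp xys).
    by rewrite (@tmul_tmon _ _ (SigSub Ms))// (@tmul_tmon _ _ t).
  case: (tmulP x y) => [s xys|_]; last by rewrite tmul0l.
  rewrite tmul_tmon0// => t szt.
  have [q /(is_sum_uniq yzr) <-] := is_sumA xys szt.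
  exact: nxr.
rewrite tmul0r; case: (tmulP x y) => [s xys|_]; last by rewrite tmul0l.
by rewrite tmul_tmon0// => t szt; have [q /nyz] := is_sumA xys szt.
Qed.

Lemma tmul1 : left_id tone tmul.
Proof.
move=> f; elim/toric_ind: f => [x||k f g Ef Eg].
- have /set_mem[c _ [u Mu Eu]] := valP x; rewrite /tone.
  case: pickP => [d _|/(_ c)//]; apply: tmul_tmon; rewrite /= (chart0 M d c).
  by exists c, 0, u; split; rewrite ?add0r//; exact: mon0.
- exact: tmul0r.
- by rewrite tmulPr Ef Eg.
Qed.

Lemma tmulDl : left_distributive tmul +%R.
Proof. by move=> f g h; have := tmulPl 1 f g h; rewrite !scale1r. Qed.

HB.instance Definition _ :=
  GRing.Zmodule_isComPzRing.Build A tmulA tmulC tmul1 tmulDl.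

Lemma toric_scalerAl k f g : k *: (f * g) = (k *: f) * g.
Proof.
by have := tmulPl k f 0 g; rewrite addr0 tmul0l addr0 => <-.
Qed.

End ToricRing.

Section PolynomialIdeals.
Variables (K : fieldType) (n : nat).
Implicit Types (f g : {mpoly K[n]}) (I : set {mpoly K[n]}).

Definition radical_ideal I : Prop := forall g k, I (g ^+ k) -> I g.

Definition wdeg (w : 'I_n -> nat) (m : 'X_{1..n}) : nat :=
  (\sum_(e < n) m e * w e)%N.

Fact wdeg0 w : wdeg w 0%MM = 0%N.
Proof. by rewrite /wdeg big1 // => e _; rewrite mnm0E. Qed.

Fact wdegD w : {morph wdeg w : m1 m2 / (m1 + m2)%MM >-> (m1 + m2)%N}.
Proof.
move=> m1 m2; rewrite /wdeg -big_split; apply: eq_bigr => e _ /=.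
by rewrite mnmDE mulnDl.
Qed.

HB.instance Definition _ w := isMeasure.Build n (wdeg w) (wdeg0 w) (wdegD w).

(* [mmeasure mf f] is one plus the largest degree of a monomial of [f]. *)
Definition initial_component (w : 'I_n -> nat) f : {mpoly K[n]} :=
  pihomog (wdeg w) (mmeasure (wdeg w) f).-1 f.

Definition initial_ideal (w : 'I_n -> nat) I : set {mpoly K[n]} :=
  ideal_hull (initial_component w @` I).

End PolynomialIdeals.

Section Presentation.
Variables (K : fieldType) (R : realType) (X : choiceType).
Variables (S : conicalComplex R X) (M : monoidalComplex S).
Variables (n : nat) (a : 'I_n -> monsupp M).

Definition generating_family : Prop :=
  forall c, monoid_hull [set u | mon M c u /\ exists e, chart c u = val (a e)]
            = mon M c.

(* This is [mmap], which cannot be used as [toricRing K M] may be zero. *)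
Definition toric_map (p : {mpoly K[n]}) : toricRing K M :=
  \sum_(m <- msupp p) p@_m *: \prod_(e < n) tmon K (a e) ^+ m e.

Definition toric_ideal : set {mpoly K[n]} := [set p | toric_map p = 0].

End Presentation.

Arguments toric_map K {R X S M n} a p.
Arguments toric_ideal K {R X S M n} a _.

Section Subdivision.
Variables (R : realType) (X : choiceType).
Variables (S : conicalComplex R X) (M : monoidalComplex S).
Variables (n : nat) (a : 'I_n -> monsupp M) (w : 'I_n -> nat).

Definition is_min (A : set R) (h : R) : Prop :=
  A h /\ forall h', A h' -> h <= h'.

Definition at_height d (u : 'rV[R]_d) (h : R) : 'rV[R]_(d + 1) :=
  row_mx u (const_mx h).

Definition lifted_cone (c : face S) : set 'rV[R]_(delta c + 1) :=
  cone_hull [set z | exists (e : 'I_n) (u : 'rV[R]_(delta c)),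
    [/\ cone c u, chart c u = val (a e) & z = at_height u (w e)%:R]].

Arguments lifted_cone : clear implicits.

Definition is_height (x : X) (h : R) : Prop :=
  exists (c : face S) (u : 'rV[R]_(delta c)),
    [/\ smallest_face [set x] c, cone c u, chart c u = x
      & is_min [set h' | lifted_cone c (at_height u h')] h].

Definition bottom (c : face S) : set 'rV[R]_(delta c + 1) :=
  [set z | exists (u : 'rV[R]_(delta c)) (h : R),
    z = at_height u h /\ is_min [set h' | lifted_cone c (at_height u h')] h].

Arguments bottom : clear implicits.

(* The faces of Gamma_w as subsets of |Sigma|. *)
Definition Gamma : set (set X) :=
  [set d | exists (c : face S) (F : set 'rV[R]_(delta c + 1)),
    [/\ is_face (lifted_cone c) F, F `<=` bottom c
      & d = [set chart c (lsubmx z) | z in F]]].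

Definition Gamma_facet (d : set X) : Prop :=
  Gamma d /\ forall d', Gamma d' -> d `<=` d' -> d' = d.

(* N_{d,w}, in the coordinates of a face [c] containing [d]; there D_d is
   [cone c `&` chart c @^-1` d]. *)
Definition N_monoid (c : face S) (d : set X) : set 'rV[R]_(delta c) :=
  monoid_hull [set u | exists e : 'I_n,
    [/\ (cone c `&` chart c @^-1` d) u, chart c u = val (a e)
      & is_height (val (a e)) (w e)%:R]].

End Subdivision.

Arguments lifted_cone {R X S M n} a w c _.
Arguments bottom {R X S M n} a w c _.
Arguments N_monoid {R X S M n} a w c d _.

(* Main.v *)
From HB Require Import structures.
Require Import Defs.
From mathcomp Require Import all_boot all_order all_algebra.
From mathcomp Require Import boolp classical_sets functions reals.
From mathcomp.multinomials Require Import freeg mpoly ssrcomplements.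
From mathcomp Require Import ring lra.

(** Say that a monomial represents [x] in |M| if its image in the toric face
    ring is [t^x], and minimally so if no other representative of [x] has
    smaller weight.  A polynomial lies in I_M iff for every [x] its coefficients
    at the representatives of [x] sum to zero, and it lies in in_w(I_M) iff this
    holds for the minimal representatives.  Both statements of the theorem are
    equivalent to: the minimal weight over each [x] equals [ht_w x].

    The height is the value of a linear program with integral data.  Duality
    over the reals gives, above each point, a face of the lifted cone inside
    the bottom; the monoids N_{d,w} are the monoids of the monomials supported
    on such faces, which are exactly those of weight the height.  Duality over
    the rationals shows that, if the minimal weight [k] of [x] exceeds the
    height, then some multiple [N x] has a representative of weight below
    [N k]; then the [N]-th power of a minimal representative of [x] lies in the
    initial ideal, but the representative does not.

    Conversely, if minimal weights are heights, then over the points below a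
    face of the bottom the residue ring of the initial ideal multiplies like
    the algebra of a submonoid of Z^delta, which is reduced: a generic linear
    form Z^delta -> Z maps it to Laurent polynomials in one variable,
    injectively on a given finite set of degrees. *)

Set Implicit Arguments.
Unset Strict Implicit.
Unset Printing Implicit Defensive.

Import Order.TTheory GRing.Theory Num.Theory.

Local Open Scope classical_set_scope.
Local Open Scope ring_scope.

(** * Linear programming *)

Section Farkas.
Variables (F : realFieldType) (d : nat).

(** Induction on the number of generators. A functional separating [b] from the other generators
    works unless it is negative on [v0]; then everything is projected along [v0] onto its kernel,
    and either outcome there lifts back. *)
Lemma farkas n (v : 'I_n -> 'rV[F]_d) (b : 'rV[F]_d) :
  (exists2 l : 'I_n -> F, forall i, 0 <= l i & b = \sum_i l i *: v i) \/
  (exists2 y : 'cV[F]_d, forall i, 0 <= (v i *m y) 0 0 & (b *m y) 0 0 < 0).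
Proof.
elim: n v b => [|n IH] v b.
  have [->|bN0] := eqVneq b 0.
    by left; exists (fun=> 0) => //; rewrite big_ord0.
  right; exists (- b^T) => [[]//|].
  have /rV0Pn[j bj] := bN0.
  rewrite mulmxN mxE oppr_lt0 mxE (bigD1 j) //= mxE.
  apply: ltr_pwDl; first by rewrite -expr2 exprn_even_gt0.
  by apply: sumr_ge0 => k _; rewrite mxE -expr2 sqr_ge0.
pose v' i := v (fintype.lift ord0 i); pose v0 := v ord0.
have [[l l0 ->]|[y yv yb]] := IH v' b.
  left; exists (fun i : 'I_n.+1 => oapp l 0 (unlift ord0 i)) => [i|].
    by case: unliftP => //= j _.
  rewrite big_ord_recl unlift_none scale0r add0r.
  by apply: eq_bigr => i _; rewrite liftK.
pose t := (v0 *m y) 0 0; have [t0|t0] := leP 0 t.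
  by right; exists y => // i; case: (unliftP ord0 i) => [j ->|->]; [exact: yv|].
pose pr x := x - ((x *m y) 0 0 / t) *: v0.
have [[l l0 E]|[z zv zb]] := IH (pr \o v') (pr b).
  (* The coefficient of [v0] restores what the projection removed. It is non-negative because [y] is
     negative on [b] and on [v0] but not on the other generators. *)
  pose s := \sum_i l i * ((v' i *m y) 0 0 / t).
  pose l' (i : 'I_n.+1) := oapp l ((b *m y) 0 0 / t - s) (unlift ord0 i).
  left; exists l' => [i|]; rewrite /l'.
    case: unliftP => //= _; rewrite subr_ge0 (@le_trans _ _ 0) //.
      apply: sumr_le0 => j _; apply: mulr_ge0_le0 => //.
      by rewrite mulr_ge0_le0 // invr_le0 ltW.
    by rewrite ltW // nmulr_rgt0 // invr_lt0.
  rewrite big_ord_recl unlift_none /= scalerBl.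
  under eq_bigr do rewrite liftK /=.
  rewrite -[LHS](subrK (((b *m y) 0 0 / t) *: v0)) -/(pr b) E addrC -!addrA.
  congr (_ + _); rewrite scaler_suml addrC -sumrB; apply: eq_bigr => i _.
  by rewrite /= /pr scalerBr scalerA.
have prE x : (pr x *m z) 0 0 = (x *m (z - ((v0 *m z) 0 0 / t) *: y)) 0 0.
  rewrite /pr mulmxBl mulmxBr -scalemxAl -scalemxAr !mxE.
  by ring.
right; exists (z - ((v0 *m z) 0 0 / t) *: y); last by rewrite -prE.
move=> i; rewrite -prE; case: (unliftP ord0 i) => [j ->|->]; first exact: zv.
by rewrite /pr divff ?lt_eqF // scale1r subrr mul0mx mxE.
Qed.

End Farkas.

(** Homogenisation: Farkas is applied to the vectors [(v_i, c_i)] and [-(u, h)] with target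
    [(0, -1)]. Dividing by the coefficient of [-(u, h)], or by the last coordinate of the separating
    functional, gives the two alternatives. *)
Lemma lp_duality (F : realFieldType) d n (v : 'I_n -> 'rV[F]_d) (c : 'I_n -> F)
    (u : 'rV[F]_d) (h : F) : (forall i, 0 <= c i) ->
  (exists l : 'I_n -> F, [/\ forall i, 0 <= l i, u = \sum_i l i *: v i
                           & \sum_i l i * c i < h]) \/
  (exists2 y : 'cV[F]_d, forall i, 0 <= (v i *m y) 0 0 + c i
                       & (u *m y) 0 0 + h <= 0).
Proof.
move=> c0.
pose g (i : 'I_n.+1) : 'rV[F]_(d + 1) :=
  oapp (fun j => row_mx (v j) (const_mx (c j))) (- row_mx u (const_mx h))
       (unlift ord0 i).
have dot (x : 'rV[F]_d) (t : F) (y : 'cV[F]_(d + 1)) :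
    (row_mx x (const_mx t) *m y) 0 0 =
    (x *m usubmx y) 0 0 + t * (dsubmx y) 0 0.
  rewrite -{1}[y]vsubmxK mul_row_col [LHS]mxE; congr (_ + _).
  by rewrite [LHS]mxE big_ord1 mxE.
have [[l l0 E]|[y gy by0]] := farkas g (row_mx 0 (const_mx (- 1))).
  pose m := l ord0; pose l' i := l (fintype.lift ord0 i).
  have : row_mx 0 (const_mx (- 1)) =
         row_mx (- (m *: u) + \sum_i l' i *: v i)
                (const_mx (- (m * h) + \sum_i l' i * c i)) :> 'rV[F]_(d + 1).
    rewrite E big_ord_recl {1}/g unlift_none /= scalerN scale_row_mx opp_row_mx.
    have -> : \sum_(i < n) l (fintype.lift ord0 i) *: g (fintype.lift ord0 i) =
        row_mx (\sum_i l' i *: v i) (const_mx (\sum_i l' i * c i)).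
      apply/rowP => j; rewrite -[j]splitK /unsplit summxE.
      case: (fintype.split j) => k; rewrite ?row_mxEl ?row_mxEr.
        rewrite summxE; apply: eq_bigr => i _.
        by rewrite /g liftK /= !mxE (unsplitK (inl k : 'I_d + 'I_1)).
      rewrite mxE; apply: eq_bigr => i _.
      by rewrite /g liftK /= !mxE (unsplitK (inr k : 'I_d + 'I_1)) mxE.
    rewrite add_row_mx; congr (row_mx _ _).
    by apply/rowP => j; rewrite !mxE.
  move=> /eq_row_mx[/esym/eqP]; rewrite addrC subr_eq0 => /eqP Eu.
  move=> /rowP/(_ 0); rewrite !mxE => Ec.
  have lc0 : 0 <= \sum_i l' i * c i.
    by apply: sumr_ge0 => i _; apply: mulr_ge0 => //; apply: l0.
  (* With [m = 0] a sum of non-negative costs would equal -1. *)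
  have m0 : 0 < m.
    rewrite lt_def l0 andbT; apply/eqP => m0.
    by move: Ec lc0; rewrite m0 mul0r oppr0 add0r => <-; rewrite oppr_ge0 ler10.
  left; exists (fun i => m^-1 * l' i); split=> [i||].
  - by rewrite mulr_ge0 ?invr_ge0 ?l0 // ltW.
  - under eq_bigr do rewrite -scalerA.
    by rewrite -scaler_sumr Eu scalerK // gt_eqF.
  - under eq_bigr do rewrite -mulrA.
    by rewrite -mulr_sumr ltr_pdivrMl //; lra.
right; move: by0; rewrite dot mul0mx mxE add0r mulN1r oppr_lt0.
set s := dsubmx y 0 0 => s0.
exists (s^-1 *: usubmx y) => [i|].
  have := gy (fintype.lift ord0 i); rewrite /g liftK /= dot -/s => H.
  rewrite -scalemxAr mxE -(pmulr_rge0 _ s0) mulrDr mulVKf ?gt_eqF //.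
  by rewrite [s * _]mulrC.
have := gy ord0; rewrite /g unlift_none /= mulNmx mxE oppr_ge0 dot -/s => H.
rewrite -scalemxAr mxE -(pmulr_rle0 _ s0) mulrDr mulVKf ?gt_eqF //.
by rewrite [s * _]mulrC.
Qed.

(** * Hulls and faces *)

Lemma cone_hullD (R : realType) (V : lmodType R) (G : set V) x y :
  cone_hull G x -> cone_hull G y -> cone_hull G (x + y).
Proof.
move=> [k [l [v [l0 Gv ->]]]] [k' [l' [v' [l0' Gv' ->]]]].
exists (k + k')%N,
  (fun i => match fintype.split i with inl j => l j | inr j => l' j end),
  (fun i => match fintype.split i with inl j => v j | inr j => v' j end).
split=> [i|i|]; [by case: (fintype.split i)|by case: (fintype.split i)|].
rewrite big_split_ord; congr (_ + _); apply: eq_bigr => i _.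
  by rewrite (unsplitK (inl i : 'I_k + 'I_k')).
by rewrite (unsplitK (inr i : 'I_k + 'I_k')).
Qed.

Lemma cone_hullZ (R : realType) (V : lmodType R) (G : set V) (t : R) x :
  0 <= t -> cone_hull G x -> cone_hull G (t *: x).
Proof.
move=> t0 [k [l [v [l0 Gv ->]]]]; exists k, (fun i => t * l i), v.
split=> // [i|]; first exact: mulr_ge0 (l0 i).
by rewrite scaler_sumr; apply: eq_bigr => i _; rewrite scalerA.
Qed.

Lemma cone_hull_sum (R : realType) (V : lmodType R) (G : set V) n
    (l : 'I_n -> R) (z : 'I_n -> V) :
  (forall i, 0 <= l i) -> (forall i, l i != 0 -> cone_hull G (z i)) ->
  cone_hull G (\sum_i l i *: z i).
Proof.
move=> l0 Gz; apply: (big_ind (cone_hull G)); first exact: cone_hull0.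
  by move=> x y; apply: cone_hullD.
move=> i _; have [->|/Gz] := eqVneq (l i) 0; last exact: cone_hullZ.
by rewrite scale0r; apply: cone_hull0.
Qed.

Lemma cone_hull_family (R : realType) (V : lmodType R) n
    (P : 'I_n -> Prop) (g : 'I_n -> V) x :
  cone_hull [set z | exists2 e, P e & z = g e] x <->
  exists l : 'I_n -> R, [/\ forall e, 0 <= l e, forall e, l e != 0 -> P e
                          & x = \sum_e l e *: g e].
Proof.
split=> [[k [l [v [l0 E ->]]]]|[l [l0 lP ->]]].
  have {E} [e Pe ve] : exists2 e, forall i, P (e i) & forall i, v i = g (e i).
    by exists (fun i => s2val (cid2 (E i))) => i; case: (cid2 (E i)).
  exists (fun j => \sum_(i | e i == j) l i); split.
  - by move=> j; apply: sumr_ge0 => i _; apply: l0.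
  - move=> j /eqP nz; apply: contrapT => nP; apply: nz.
    by apply: big1 => i /eqP Ei; case: nP; rewrite -Ei.
  - rewrite (partition_big e predT) //=; apply: eq_bigr => j _.
    by rewrite scaler_suml; apply: eq_bigr => i /eqP <-; rewrite ve.
apply: cone_hull_sum => // i /lP Pi.
exists 1%N, (fun=> 1), (fun=> g i); split=> [_|_|]; first exact: ler01.
  by exists i.
by rewrite big_ord1 scale1r.
Qed.

Lemma monoid_hull_sum (V : nmodType) (G : set V) (I : Type) (r : seq I)
    (P : pred I) (z : I -> V) :
  (forall i, P i -> monoid_hull G (z i)) ->
  monoid_hull G (\sum_(i <- r | P i) z i).
Proof.
move=> Gz; apply: (big_ind (monoid_hull G)) => //; first exact: monoid_hull0.
exact: monoid_hullD.
Qed.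

Lemma monoid_hull_family (V : nmodType) n (P : 'I_n -> Prop) (g : 'I_n -> V) x :
  monoid_hull [set z | exists2 e, P e & z = g e] x <->
  exists2 m : 'I_n -> nat, forall e, m e != 0%N -> P e
                          & x = \sum_e g e *+ m e.
Proof.
split=> [[k [v [E ->]]]|[m mP ->]].
  have {E} [e Pe ve] : exists2 e, forall i, P (e i) & forall i, v i = g (e i).
    by exists (fun i => s2val (cid2 (E i))) => i; case: (cid2 (E i)).
  exists (fun j => #|[pred i | e i == j]|).
    move=> j; rewrite -lt0n => /card_gt0P[i]; rewrite inE => /eqP <-.
    exact: Pe.
  rewrite (partition_big e predT) //=; apply: eq_bigr => j _.
  rewrite -sumr_const; apply: eq_big => [i|i /eqP <-]; rewrite ?inE //.
apply: monoid_hull_sum => e _; have [->|/mP Pe] := eqVneq (m e) 0%N.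
  by rewrite mulr0n; apply: monoid_hull0.
exists (m e), (fun=> g e); split=> [_|]; first by exists e.
by rewrite sumr_const card_ord.
Qed.

(** Extremality of faces: the defining form is non-negative on [C], so it vanishes on a non-negative
    combination only if it vanishes on each term in use. *)
Lemma face_sum (R : realType) d (C F : set 'rV[R]_d) n
    (l : 'I_n -> R) (z : 'I_n -> 'rV[R]_d) :
  is_face C F -> (forall i, 0 <= l i) -> (forall i, l i != 0 -> C (z i)) ->
  C (\sum_i l i *: z i) ->
  F (\sum_i l i *: z i) <-> forall i, l i != 0 -> F (z i).
Proof.
case=> [-> //|[y [_ Cy ->]]] l0 Cz Csum.
have yE : ((\sum_i l i *: z i) *m y) 0 0 = \sum_i l i * (z i *m y) 0 0.
  rewrite mulmx_suml summxE; apply: eq_bigr => i _.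
  by rewrite -scalemxAl mxE.
rewrite /= yE; split=> [[_ sum0] i li|Fz].
  split; first exact: Cz.
  have ge0 j : true -> 0 <= l j * (z j *m y) 0 0.
    move=> _; have [->|lj] := eqVneq (l j) 0; first by rewrite mul0r.
    by apply: mulr_ge0 => //; apply/Cy/Cz.
  have /eqP := @psumr_eq0P _ _ _ _ ge0 sum0 i isT.
  by rewrite mulf_eq0 (negPf li) => /eqP.
split=> //; apply: big1 => i _.
by have [->|/Fz[_ ->]] := eqVneq (l i) 0; rewrite ?mul0r ?mulr0.
Qed.

(** An element above [t0] with the most predecessors is maximal. As [r] is only a preorder,
    maximality is up to equivalence. *)
Lemma finite_maximal (T : finType) (r : T -> T -> Prop) (P : T -> Prop) t0 :
  (forall t, r t t) -> (forall t2 t1 t3, r t1 t2 -> r t2 t3 -> r t1 t3) ->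
  P t0 -> exists t, [/\ P t, r t0 t & forall t', P t' -> r t t' -> r t' t].
Proof.
move=> rr rt Pt0.
pose Q t := `[< P t /\ r t0 t >].
pose below t := [pred s | `[< r s t >]].
have Qt0 : Q t0 by apply/asboolP.
case: (@arg_maxnP _ t0 Q (fun t => #|below t|) Qt0) => t /asboolP[Pt t0t] tmax.
exists t; split=> // t' Pt' tt'.
have /tmax le : Q t' by apply/asboolP; split=> //; exact: (rt _ _ _ t0t tt').
have sub : below t \subset below t'.
  apply/fintype.subsetP => s; rewrite !ssrbool.inE => /asboolW st.
  apply: asboolT.
  exact: (rt _ _ _ st tt').
have E : #|below t| = #|below t'|.
  by apply/eqP; rewrite eqn_leq subset_leq_card //; exact: le.
have /(_ t') := subset_cardP E sub.
by rewrite !ssrbool.inE => H; apply: asboolW; rewrite H; apply: asboolT.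
Qed.

Lemma sum_regroup (A : pzRingType) (I : eqType) (Y : eqType) (s : seq I)
    (P : pred I) (v : I -> Y) (c : I -> A) (f : Y -> A) :
  (forall y, \sum_(i <- s | P i && (v i == y)) c i = 0) ->
  \sum_(i <- s | P i) c i * f (v i) = 0.
Proof.
move=> c0.
transitivity (\sum_(y <- undup (map v s))
    (\sum_(i <- s | P i && (v i == y)) c i) * f y); last first.
  by apply: big1 => y _; rewrite c0 mul0r.
under [RHS]eq_bigr => y _ do rewrite big_distrl /= big_mkcondr.
rewrite exchange_big /= [LHS]big_seq_cond [RHS]big_seq_cond.
apply: eq_bigr => i /andP[si _].
have vi : v i \in undup (map v s) by rewrite mem_undup map_f.
rewrite (bigD1_seq (v i)) ?undup_uniq //= eqxx big1 ?addr0 // => y.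
by rewrite eq_sym => /negPf ->.
Qed.

Lemma clear_denominators n (l : 'I_n -> rat) : (forall i, 0 <= l i) ->
  exists (N : nat) (m : 'I_n -> nat),
    (0 < N)%N /\ forall i, N%:R * l i = (m i)%:R.
Proof.
move=> l0; pose D i := `|denq (l i)|%N.
have D0 i : (0 < D i)%N by rewrite absz_gt0 denq_neq0.
exists (\prod_i D i)%N, (fun i => `|numq (l i)| * \prod_(j | j != i) D j)%N.
split=> [|i]; first exact: prodn_gt0.
rewrite (bigD1 i) //= !natrM mulrAC; congr (_ * _).
rewrite -[in LHS](divq_num_den (l i)) mulrC.
have -> : (D i)%:R = (denq (l i))%:~R :> rat.
  by rewrite /D natr_absz gtr0_norm ?denq_gt0.
rewrite divfK ?intr_eq0 ?denq_neq0 //.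
by rewrite natr_absz ger0_norm // numq_ge0.
Qed.

(** * Coordinates and heights *)

Section Coordinates.
Variables (R : realType) (X : choiceType) (S : conicalComplex R X).
Variables (M : monoidalComplex S) (n : nat) (a : 'I_n -> monsupp M).
Implicit Types (c d : face S) (l : 'I_n -> R).

(* Junk unless [a e] lies on [c]. *)
Definition coord c e : 'rV[R]_(delta c) :=
  pinv_ (fun=> 0) (cone c) (chart c) (val (a e)).

Definition comb c l : 'rV[R]_(delta c) := \sum_e l e *: coord c e.

Definition coeffs_on c l : Prop :=
  (forall e, 0 <= l e) /\ (forall e, l e != 0 -> pts c (val (a e))).

Lemma coordE c e u : cone c u -> chart c u = val (a e) -> coord c e = u.
Proof.
move=> Cu E; rewrite /coord -E pinvKV //; last exact/mem_set.
by move=> s t /set_mem Cs /set_mem Ct; apply: chart_inj.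
Qed.

Lemma mon_coord c e : pts c (val (a e)) -> mon M c (coord c e).
Proof.
move=> ce; have /set_mem[d _ [v Mv Ev]] := valP (a e).
have dv : pts c (chart d v) by rewrite Ev.
have Mt := mon_transition Mv dv.
rewrite (@coordE c e (transition d c v)) //; first exact: mon_in_cone Mt.
by rewrite chart_transition //; exact: mon_in_cone Mv.
Qed.

Lemma cone_coord c e : pts c (val (a e)) -> cone c (coord c e).
Proof. by move/mon_coord/mon_in_cone. Qed.

Lemma chart_coord c e : pts c (val (a e)) -> chart c (coord c e) = val (a e).
Proof.
move=> ce; have [_ _ /(_ _ ce)[u Cu E]] := chart_bij c.
by rewrite (coordE Cu E).
Qed.

Lemma cone_comb c l : coeffs_on c l -> cone c (comb c l).
Proof.
move=> [l0 lc]; rewrite -(mon_cone M); apply: cone_hull_sum => // e /lc ce.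
by rewrite mon_cone; apply: cone_coord.
Qed.

(** The intersection with [d] is a face of the cone of [c]; by extremality it contains every
    generator in use, and on it the transition map is linear. *)
Lemma transition_comb c d l : coeffs_on c l -> pts d (chart c (comb c l)) ->
  coeffs_on d l /\ transition c d (comb c l) = comb d l.
Proof.
move=> lc dl; have Cl := cone_comb lc; case: lc => l0 lc.
have [F [G [fF fG E _ [_ [L [_ FL]]]]]] := face_glue c d.
have Fl : F (comb c l).
  have : (pts c `&` pts d) (chart c (comb c l)).
    by split=> //; apply: chart_pts.
  by rewrite E => -[u Fu /(chart_inj (face_sub fF Fu) Cl) <-].
have Fe := (face_sum fF l0 (fun e le => cone_coord (lc e le)) Cl).1 Fl.
have ld e : l e != 0 -> pts d (val (a e)).
  move=> le; rewrite -(chart_coord (lc e le)).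
  suff [] : (pts c `&` pts d) (chart c (coord c e)) by [].
  by rewrite E; exists (coord c e) => //; apply: Fe.
split=> //; rewrite /transition FL ?linear_sum; last exact/mem_set.
apply: eq_bigr => e _; rewrite linearZ /=.
have [->|le] := eqVneq (l e) 0; first by rewrite !scale0r.
congr (_ *: _); rewrite -FL; last exact/mem_set/Fe.
apply: transitionE; first exact/cone_coord/ld.
by rewrite (chart_coord (lc e le)) (chart_coord (ld e le)).
Qed.

Lemma comb_at c d l v : coeffs_on c l -> cone d v ->
  chart c (comb c l) = chart d v -> coeffs_on d l /\ comb d l = v.
Proof.
move=> lc Cv E; have dl : pts d (chart c (comb c l)).
  by rewrite E; apply: chart_pts.
have [ld <-] := transition_comb lc dl; split=> //.
exact: transitionE.
Qed.

(** All generators in use lie in the common face of [c] and [d], hence so does their combination.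
    Thus a coefficient vector determines a point independently of the face. *)
Lemma chart_comb c d l : coeffs_on c l -> coeffs_on d l ->
  chart c (comb c l) = chart d (comb d l).
Proof.
move=> lc ld; have Cl := cone_comb lc.
have dl : pts d (chart c (comb c l)).
  have [F [G [fF _ E _ _]]] := face_glue c d.
  suff Fl : F (comb c l).
    suff [] : (pts c `&` pts d) (chart c (comb c l)) by [].
    by rewrite E; exists (comb c l).
  apply/(face_sum fF lc.1 (fun e le => cone_coord (lc.2 e le)) Cl) => e le.
  have : (pts c `&` pts d) (chart c (coord c e)).
    by rewrite (chart_coord (lc.2 e le)); split; [apply: lc.2|apply: ld.2].
  rewrite E => -[u Fu /(chart_inj (face_sub fF Fu)) <- //].
  exact/cone_coord/lc.2.
by have [_ <-] := transition_comb lc dl; rewrite chart_transition.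
Qed.

Hypothesis ha : generating_family a.

Lemma mon_comb c u : mon M c u <-> exists2 m : 'I_n -> nat,
  coeffs_on c (fun e => (m e)%:R) & u = comb c (fun e => (m e)%:R).
Proof.
rewrite -(ha c).
rewrite (_ : [set _ | _] =
             [set v | exists2 e, pts c (val (a e)) & v = coord c e]).
  split=> [/monoid_hull_family|] [m mc ->].
    exists m; last by apply: eq_bigr => e _; rewrite scaler_nat.
    by split=> // e; rewrite pnatr_eq0 => /mc.
  apply/monoid_hull_family; exists m.
    by move=> e me; apply: mc.2; rewrite pnatr_eq0.
  by apply: eq_bigr => e _; rewrite scaler_nat.
apply/seteqP; split=> v /=.
  move=> [Mv [e E]]; exists e; last by rewrite (coordE (mon_in_cone Mv) E).
  by rewrite -E; apply/chart_pts/(mon_in_cone Mv).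
by move=> [e ce ->]; split; [exact: mon_coord|exists e; apply: chart_coord].
Qed.

Lemma cone_combP c u : cone c u <-> exists2 l, coeffs_on c l & u = comb c l.
Proof.
split=> [|[l lc ->]]; last exact: cone_comb.
rewrite -(mon_cone M) => -[k [t [v [t0 Mv ->]]]].
have : cone_hull [set v | exists2 e, pts c (val (a e)) & v = coord c e]
                 (\sum_i t i *: v i).
  apply: cone_hull_sum => // i _; have /mon_comb[m [m0 mc] ->] := Mv i.
  by apply/cone_hull_family; exists (fun e => (m e)%:R).
by move=> /cone_hull_family[l [l0 lc E]]; exists l.
Qed.

End Coordinates.

(** * Heights and the lower side of the lifted cones *)

Section Heights.
Variables (R : realType) (X : choiceType) (S : conicalComplex R X).
Variables (M : monoidalComplex S) (n : nat) (a : 'I_n -> monsupp M).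
Hypothesis ha : generating_family a.
Variable w : 'I_n -> nat.
Implicit Types (c d : face S) (l : 'I_n -> R).

Local Notation wt l := (\sum_e l e * (w e)%:R).
Local Notation lift_of c l := (at_height (comb a c l) (wt l)).
Local Notation gen c e := (at_height (coord a c e) (w e)%:R).

Lemma wt_ge0 l : (forall e, 0 <= l e) -> 0 <= wt l.
Proof. by move=> l0; apply: sumr_ge0 => e _; rewrite mulr_ge0. Qed.

Lemma sum_gen c l : \sum_e l e *: gen c e = lift_of c l.
Proof.
apply/rowP => j; rewrite -[j]splitK /unsplit summxE.
case: (fintype.split j) => k; rewrite ?row_mxEl ?row_mxEr.
  by rewrite summxE; apply: eq_bigr => e _; rewrite mxE row_mxEl mxE.
by rewrite mxE; apply: eq_bigr => e _; rewrite mxE row_mxEr mxE.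
Qed.

Lemma at_height_inj m (u v : 'rV[R]_m) h k :
  at_height u h = at_height v k -> u = v /\ h = k.
Proof. by move=> /eq_row_mx[-> /rowP/(_ 0)]; rewrite !mxE. Qed.

Lemma at_height_dot m (u : 'rV[R]_m) h (y : 'cV_(m + 1)) :
  (at_height u h *m y) 0 0 =
  (u *m usubmx y) 0 0 + h * (dsubmx y) 0 0.
Proof.
rewrite -{1}[y]vsubmxK mul_row_col [LHS]mxE; congr (_ + _).
by rewrite [LHS]mxE big_ord1 mxE.
Qed.

Lemma lifted_coneE c :
  lifted_cone a w c =
  cone_hull [set z | exists2 e, pts c (val (a e)) & z = gen c e].
Proof.
rewrite /lifted_cone; congr cone_hull; apply/seteqP; split=> z /=.
  move=> [e [u [Cu E ->]]]; exists e; first by rewrite -E; apply: chart_pts.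
  by rewrite (coordE Cu E).
move=> [e ce ->]; exists e, (coord a c e).
by split=> //; [apply: cone_coord|apply: chart_coord].
Qed.

Lemma lifted_gen c e : pts c (val (a e)) -> lifted_cone a w c (gen c e).
Proof.
move=> ce; rewrite lifted_coneE; exists 1%N, (fun=> 1), (fun=> gen c e).
by split=> [_|_|]; [exact: ler01|exists e|rewrite big_ord1 scale1r].
Qed.

Lemma lifted_coneP c z : lifted_cone a w c z <->
  exists2 l, coeffs_on a c l & z = lift_of c l.
Proof.
rewrite lifted_coneE; split=> [/cone_hull_family[l [l0 lc ->]]|[l [l0 lc] ->]].
  by exists l => //; apply: sum_gen.
by apply/cone_hull_family; exists l; rewrite sum_gen.
Qed.

Lemma lifted_at c d u v h : lifted_cone a w c (at_height u h) ->
  cone d v -> chart c u = chart d v -> lifted_cone a w d (at_height v h).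
Proof.
move=> /lifted_coneP[l lc /at_height_inj[-> ->]] Cv E.
by have [ld <-] := comb_at lc Cv E; apply/lifted_coneP; exists l.
Qed.

(** The minimal height computed in any face containing the point, whereas [is_height] uses the
    smallest one; [is_heightE] identifies the two. *)
Definition lowest c u h : Prop :=
  is_min [set h' | lifted_cone a w c (at_height u h')] h.

Arguments lowest : clear implicits.

Lemma lowest_uniq c u h k : lowest c u h -> lowest c u k -> h = k.
Proof.
move=> [uh hmin] [uk kmin].
by apply/le_anti/andP; split; [apply: hmin|apply: kmin].
Qed.

Lemma lowest_at c d u v h : lowest c u h -> cone c u -> cone d v ->
  chart c u = chart d v -> lowest d v h.
Proof.
move=> [uh hmin] Cu Cv E; split; first exact: lifted_at uh Cv E.
by move=> h' /lifted_at/(_ Cu (esym E))/hmin.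
Qed.

(** Two faces of the complex meet in a face of the complex, so a minimal one among those containing
    [A] lies in all of them. *)
Lemma smallest_face_exists (A : set X) c0 : A `<=` pts c0 ->
  exists c : face S, smallest_face A c.
Proof.
move=> Ac0.
have [|t2 t1 t3 le1 le2|c [Ac _ cmin]] :=
  @finite_maximal _ (fun c d : face S => pts d `<=` pts c)
    (fun c => A `<=` pts c) c0 _ _ Ac0.
- by move=> t.
- exact: subset_trans le2 le1.
exists c; split=> // d Ad.
have [F [G [fF _ E _ _]]] := face_glue c d.
have [c' Ec'] := face_closed fF.
have {}E : pts c' = pts c `&` pts d by rewrite -Ec' -E.
have /cmin H : A `<=` pts c' by rewrite E => x Ax; split; [apply: Ac|apply: Ad].
have : pts c `<=` pts c' by apply: H; rewrite E; apply: subIsetl.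
by rewrite E => /subset_trans; apply; apply: subIsetr.
Qed.

Lemma is_heightE c u h : cone c u ->
  is_height a w (chart c u) h <-> lowest c u h.
Proof.
move=> Cu; split=> [[d [v [_ Cv E low]]]|low].
  exact: lowest_at low Cv Cu E.
have [|d sd] := @smallest_face_exists [set chart c u] c.
  by move=> _ ->; apply: chart_pts.
have [_ _ /(_ (chart c u))[|v Cv E]] := chart_bij d; first exact: sd.1.
exists d, v; split=> //; exact: lowest_at low Cu Cv (esym E).
Qed.

Lemma lowest_le c l h : coeffs_on a c l -> lowest c (comb a c l) h -> h <= wt l.
Proof. by move=> lc [_]; apply; apply/lifted_coneP; exists l. Qed.

(** The infimum is attained because finitely generated cones are closed. This enters through Farkas:
    a functional separating the point at height [inf A] from the lifted cone would be negative
    somewhere on the cone over [u]. *)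
Lemma lowest_exists c u : cone c u -> exists h, lowest c u h.
Proof.
move=> Cu; pose A := [set h | lifted_cone a w c (at_height u h)].
have A_ge0 h : A h -> 0 <= h.
  by move=> /lifted_coneP[l [l0 _] /at_height_inj[_ ->]]; apply: wt_ge0.
have [l lc ul] := (cone_combP ha u).1 Cu.
have A0 : A (wt l) by apply/lifted_coneP; exists l; rewrite // ul.
have infA : has_inf A by split; [exists (wt l)|exists 0 => h /A_ge0].
exists (inf A); split; last by move=> h Ah; apply: ge_inf => //; exact: infA.2.
(* Generators outside [c] become 0, which keeps the index set and does not change the cone. *)
pose v e : 'rV_(delta c + 1) := if `[< pts c (val (a e)) >] then gen c e else 0.
have [[t t0 E]|[y vy uy]] := farkas v (at_height u (inf A)).
  rewrite /= E lifted_coneE; apply: cone_hull_sum => // e _; rewrite /v.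
  case: asboolP => [ce|_]; last exact: cone_hull0.
  by rewrite -lifted_coneE; apply: lifted_gen.
have Ay h : A h -> 0 <= (at_height u h *m y) 0 0.
  move=> /lifted_coneP[t [t0 tc] ->]; rewrite -sum_gen mulmx_suml summxE.
  apply: sumr_ge0 => e _; rewrite -scalemxAl mxE.
  have [->|/tc ce] := eqVneq (t e) 0; first by rewrite mul0r.
  by apply: mulr_ge0 => //; have := vy e; rewrite /v asboolT.
move: uy; rewrite at_height_dot; set al := (u *m _) 0 0; set s := dsubmx y 0 0.
(* For [s <= 0] the functional is also negative at height [wt l], which is at least the infimum; for
   [s > 0] it is negative at all heights below [- al / s], which exceeds the infimum. *)
move=> neg; have [s0|s0] := leP s 0.
  have := Ay _ A0; rewrite at_height_dot -/al -/s.
  have : inf A <= wt l by apply: ge_inf => //; exact: infA.2.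
  by nra.
have [||h Ah] := @inf_adherent _ A (- al / s - inf A).
- by rewrite subr_gt0 ltr_pdivlMr //; lra.
- by [].
have := Ay _ Ah; rewrite at_height_dot -/al -/s => hy.
by rewrite addrC subrK ltr_pdivlMr //; lra.
Qed.

Local Notation on c x e := (if `[< pts c (val (a e)) >] then x else 0).

(** No combination is cheaper than [h], so duality yields a functional which, extended by the last
    coordinate 1, is non-negative on the lifted cone and vanishes at [(u, h)]. Its zero set is the
    face; over each point only the lowest height can give 0. *)
Lemma lowest_face c u h : lowest c u h -> exists F,
  [/\ is_face (lifted_cone a w c) F, F `<=` bottom a w c & F (at_height u h)].
Proof.
move=> [uh hmin].
have [e|[l [l0 ul lh]]|[y vy uy]] :=
  @lp_duality _ _ _ (fun e => on c (coord a c e) e)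
    (fun e => on c (w e)%:R e) u h.
- by case: ifP.
- pose l' e := on c (l e) e.
  have l'c : coeffs_on a c l'.
    split=> e; rewrite /l'; case: asboolP => // _; by rewrite ?eqxx.
  have ul' : u = comb a c l'.
    rewrite ul; apply: eq_bigr => e _; rewrite /l'.
    by case: asboolP; rewrite // scale0r scaler0.
  have : h <= wt l'.
    by apply: hmin; apply/lifted_coneP; exists l'; rewrite // -ul'.
  rewrite leNgt => /negP[]; apply: le_lt_trans lh.
  rewrite le_eqVlt; apply/orP; left; apply/eqP; apply: eq_bigr => e _.
  by rewrite /l'; case: asboolP; rewrite // mul0r mulr0.
pose z : 'cV_(delta c + 1) := col_mx y (const_mx 1).
have zE v k : (at_height v k *m z) 0 0 = (v *m y) 0 0 + k.
  by rewrite at_height_dot col_mxKu col_mxKd [const_mx 1 0 0]mxE mulr1.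
have zge x : lifted_cone a w c x -> 0 <= (x *m z) 0 0.
  move=> /lifted_coneP[l [l0 lc] ->]; rewrite -sum_gen mulmx_suml summxE.
  apply: sumr_ge0 => e _; rewrite -scalemxAl mxE zE.
  have [->|/lc ce] := eqVneq (l e) 0; first by rewrite mul0r.
  by apply: mulr_ge0 => //; have := vy e; rewrite !asboolT.
exists (lifted_cone a w c `&` [set x | (x *m z) 0 0 = 0]); split.
- right; exists z; split=> //; apply/eqP => /matrixP/(_ (rshift _ 0) 0).
  by rewrite col_mxEd !mxE => /eqP; rewrite oner_eq0.
- move=> x [/[dup] Cx /lifted_coneP[l lc xl] /= x0].
  exists (comb a c l), (wt l); split=> //; split; first by rewrite /= -xl.
  by move=> h' /zge; move: x0; rewrite xl !zE; lra.
- split=> //=; apply/eqP; rewrite eq_le zge // andbT zE //.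
Qed.

Lemma int_coord c : exists z : 'I_n -> 'rV[int]_(delta c),
  forall e, pts c (val (a e)) -> coord a c e = map_mx intr (z e).
Proof.
have H e : exists z : 'rV[int]_(delta c),
    pts c (val (a e)) -> coord a c e = map_mx intr z.
  have [ce|] := pselect (pts c (val (a e))); last by exists 0.
  have [_ /mxOverP iu] := mon_sub (mon_coord ce).
  exists (\row_j Num.floor (coord a c e 0 j)) => _.
  apply/rowP => j; rewrite !mxE.
  by have /intrP[k ->] := iu 0 j; rewrite intrKfloor.
by exists (fun e => projT1 (cid (H e))) => e; case: (cid (H e)).
Qed.

(** Duality over the rationals with bound [k]. A primal solution gives [N] and [m] after clearing
    denominators; a dual one would remain valid over [R] and contradict [h < k]. *)
Lemma lowest_rational c u (k : nat) h : mon M c u -> lowest c u h -> h < k%:R ->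
  exists (N : nat) (m : 'I_n -> nat),
    [/\ coeffs_on a c (fun e => (m e)%:R),
        comb a c (fun e => (m e)%:R) = N%:R *: u
      & (\sum_e m e * w e < N * k)%N].
Proof.
move=> Mu [/lifted_coneP[l lc /at_height_inj[ul hl]] _] hk.
have [z zE] := int_coord c.
have [q [_ qc] uq] := (mon_comb ha u).1 Mu.
pose zu := \sum_e z e *+ q e.
have uzu : u = map_mx intr zu.
  rewrite uq /comb raddf_sum; apply: eq_bigr => e _ /=.
  rewrite raddfMn /= -scaler_nat.
  have [->|qe] := eqVneq (q e) 0%N; first by rewrite !scale0r.
  by rewrite zE //; apply: qc; rewrite pnatr_eq0.
pose v e : 'rV[rat]_(delta c) := on c (map_mx intr (z e)) e.
pose wq e : rat := on c (w e)%:R e.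
have [e|[t [t0 ut th]]|[y vy uy]] :=
  @lp_duality _ _ _ v wq (map_mx intr zu) k%:R.
- by rewrite /wq; case: ifP.
- have [N [m [N0 Nt]]] := clear_denominators t0.
  pose m' e := if `[< pts c (val (a e)) >] then m e else 0%N.
  exists N, m'; split.
  + split=> e; first exact: ler0n.
    by rewrite /m'; case: asboolP => // _; by rewrite ?eqxx.
  + rewrite uzu /comb.
    transitivity (map_mx intr (\sum_e z e *+ m' e) : 'rV[R]__).
      rewrite raddf_sum; apply: eq_bigr => e _.
      rewrite /= raddfMn /= -scaler_nat.
      by rewrite /m'; case: asboolP => [/zE ->|_]; rewrite ?scale0r.
    rewrite scaler_nat -raddfMn; congr map_mx.
    have inj : injective
        (map_mx intr : 'rV[int]_(delta c) -> 'rV[rat]_(delta c)).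
      move=> x x' /rowP xx'; apply/rowP => j.
      by have := xx' j; rewrite !mxE => /intr_inj.
    apply: inj.
    rewrite raddfMn /= ut -scaler_nat scaler_sumr raddf_sum.
    apply: eq_bigr => e _; rewrite /= raddfMn scalerA Nt -scaler_nat /v /m'.
    by case: asboolP; rewrite ?scale0r ?scaler0.
  + rewrite -(ltr_nat rat) natr_sum natrM.
    suff -> : \sum_e (m' e * w e)%:R = N%:R * \sum_e t e * wq e.
      by rewrite ltr_pM2l // ltr0n.
    rewrite mulr_sumr; apply: eq_bigr => e _; rewrite natrM mulrA Nt /m' /wq.
    by case: asboolP; rewrite // mul0r mulr0.
pose yR : 'cV[R]_(delta c) := map_mx ratr y.
have ratE (x : 'rV[int]_(delta c)) :
    (map_mx intr x *m yR) 0 0 = ratr ((map_mx intr x *m y) 0 0).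
  rewrite !mxE rmorph_sum; apply: eq_bigr => j _.
  by rewrite !mxE rmorphM /= ratr_int.
(* Weak duality: the real coefficients [l] of cost [h] bound the functional at [u] below by [-h],
   while the dual solution bounds it above by [-k]. *)
have : 0 <= (u *m yR) 0 0 + h.
  rewrite ul hl mulmx_suml summxE -big_split; apply: sumr_ge0 => e _ /=.
  rewrite -scalemxAl mxE -mulrDr.
  have [->|/lc.2 ce] := eqVneq (l e) 0; first by rewrite mul0r.
  apply: mulr_ge0; first exact: lc.1.
  rewrite zE // ratE -(ratr_nat R) -rmorphD ler0q.
  by have := vy e; rewrite /v /wq asboolT.
have : (u *m yR) 0 0 + k%:R <= 0.
  by rewrite uzu ratE -(ratr_nat R) -rmorphD lerq0.
lra.
Qed.

End Heights.

Arguments lowest {R X S M n} a w c u h.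

(** * The subdivision *)

Section Subdivision.
Variables (R : realType) (X : choiceType) (S : conicalComplex R X).
Variables (M : monoidalComplex S) (n : nat) (a : 'I_n -> monsupp M).
Hypothesis ha : generating_family a.
Variable w : 'I_n -> nat.
Implicit Types (c : face S) (l : 'I_n -> R) (m : 'X_{1..n}).

Local Notation wt l := (\sum_e l e * (w e)%:R).
Local Notation lift_of c l := (at_height (comb a c l) (wt l)).
Local Notation gen c e := (at_height (coord a c e) (w e)%:R).

Definition exponent m : 'I_n -> R := fun e => (m e)%:R.

(** Stated in coordinates, hence independently of the field; [toric_monomialP] relates it to the
    image of the monomial. *)
Definition represents m (x : X) : Prop :=
  exists c : face S,
    coeffs_on a c (exponent m) /\ chart c (comb a c (exponent m)) = x.

Definition min_represents m (x : X) : Prop :=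
  represents m x /\ forall m', represents m' x -> (wdeg w m <= wdeg w m')%N.

Lemma wt_exponent m : wt (exponent m) = (wdeg w m)%:R.
Proof. by rewrite natr_sum; apply: eq_bigr => e _; rewrite natrM. Qed.

Lemma exponent_neq0 m e : (exponent m e != 0) = (m e != 0%N).
Proof. by rewrite /exponent pnatr_eq0. Qed.

Lemma represents_at m x c u : represents m x -> cone c u -> chart c u = x ->
  coeffs_on a c (exponent m) /\ comb a c (exponent m) = u.
Proof. by move=> [d [md <-]] Cu E; apply: comb_at md Cu (esym E). Qed.

Lemma represents_cone m x : represents m x ->
  exists (c : face S) (u : 'rV_(delta c)),
    [/\ mon M c u, cone c u & chart c u = x].
Proof.
move=> [c [mc <-]]; exists c, (comb a c (exponent m)).
split=> //; last exact: cone_comb.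
by apply/(mon_comb ha); exists m.
Qed.

Lemma represents_uniq m x y : represents m x -> represents m y -> x = y.
Proof.
by move=> [c [mc <-]] [d [md <-]]; apply: chart_comb.
Qed.

Lemma represents_exists c u : mon M c u -> exists m, represents m (chart c u).
Proof.
move=> /(mon_comb ha)[m mc ->].
have E : exponent [multinom m e | e < n] = (fun e => (m e)%:R).
  by apply/funext => e; rewrite /exponent mnmE.
by exists [multinom m e | e < n], c; rewrite E.
Qed.

Lemma min_represents_exists m x : represents m x ->
  exists m', min_represents m' x.
Proof.
move: {2}(wdeg w m) (leqnn (wdeg w m)) => k.
elim: k m => [|k IH] m mk mx.
  by exists m; split=> // m' _; rewrite leqn0 in mk; rewrite (eqP mk).
have [lt|ge] :=
  pselect (exists2 m', represents m' x & (wdeg w m' < wdeg w m)%N).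
  case: lt => m' m'x m'm; apply: (IH m') => //; rewrite -ltnS.
  exact: leq_trans m'm mk.
exists m; split=> // m' m'x; rewrite leqNgt; apply/negP => lt.
by apply: ge; exists m'.
Qed.

Lemma lowest_le_wdeg m x c u h : represents m x -> chart c u = x -> cone c u ->
  lowest a w c u h -> h <= (wdeg w m)%:R.
Proof.
move=> mx Eu Cu; have [mc <-] := represents_at mx Cu Eu.
by rewrite -wt_exponent; apply: lowest_le.
Qed.

Section Face.
Variables (c : face S) (F : set 'rV[R]_(delta c + 1)).
Hypotheses (fF : is_face (lifted_cone a w c) F) (Fb : F `<=` bottom a w c).

Lemma face_lowest u h : F (at_height u h) -> lowest a w c u h.
Proof. by move=> /Fb[v [k [/at_height_inj[-> ->]]]]. Qed.

Lemma face_lift_of l : coeffs_on a c l ->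
  F (lift_of c l) <-> forall e, l e != 0 -> F (gen c e).
Proof.
move=> lc; have Cl : lifted_cone a w c (lift_of c l).
  by apply/lifted_coneP; exists l.
rewrite -sum_gen; apply: (face_sum fF).
- exact: lc.1.
- by move=> e /lc.2; apply: lifted_gen.
- by rewrite sum_gen.
Qed.

Lemma face_atE z : F z ->
  exists u h, [/\ z = at_height u h, cone c u & lowest a w c u h].
Proof.
move=> Fz; have [u [h [zE low]]] := Fb Fz; exists u, h; split=> //.
have /lifted_coneP[l lc] := face_sub fF Fz.
by rewrite zE => /at_height_inj[-> _]; apply: cone_comb.
Qed.

Let d := [set chart c (lsubmx z) | z in F].

Lemma Gamma_face : Gamma a w d.
Proof. by exists c, F. Qed.

Lemma Gamma_sub : d `<=` pts c.
Proof.
move=> _ [z /face_atE[u [h [-> Cu _]]] <-].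
by rewrite row_mxKl; apply: chart_pts.
Qed.

Lemma Gamma_at x : d x -> exists u h,
  [/\ cone c u, chart c u = x, F (at_height u h) & lowest a w c u h].
Proof.
move=> [z Fz <-]; have [u [h [zE Cu low]]] := face_atE Fz.
by exists u, h; split; rewrite -?zE // zE row_mxKl.
Qed.

Lemma Gamma_lift u h : F (at_height u h) -> d (chart c u).
Proof. by move=> Fu; exists (at_height u h); rewrite ?row_mxKl. Qed.

(** Over a point of [d] the face [F] contains exactly the lowest lift. With [gen_Gamma], the
    generators of [N_{d,w}] are those whose lifts lie in [F]. *)
Lemma Gamma_gen e : d (val (a e)) -> is_height a w (val (a e)) (w e)%:R ->
  F (gen c e).
Proof.
move=> /Gamma_at[u [h [Cu Eu Fu low]]].
rewrite -Eu (is_heightE _ _ _ Cu) => /(lowest_uniq low) <-.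
by rewrite (coordE Cu Eu).
Qed.

Lemma gen_Gamma e : pts c (val (a e)) -> F (gen c e) ->
  d (val (a e)) /\ is_height a w (val (a e)) (w e)%:R.
Proof.
move=> ce Fe; rewrite -(chart_coord ce); split; first exact: Gamma_lift Fe.
apply/(is_heightE _ _ _ (cone_coord ce)); exact: face_lowest.
Qed.

End Face.

(** A face of Gamma_w is determined by a face [c] and the set of generators whose lifts lie in [F];
    this encodes Gamma_w in a finite type, where a maximal element exists. *)
Lemma Gamma_facet_above d0 : Gamma a w d0 ->
  exists2 d, Gamma_facet a w d & d0 `<=` d.
Proof.
pose D (t : face S * {ffun 'I_n -> bool}) : set X :=
  [set x | exists l, [/\ coeffs_on a t.1 l, forall e, l e != 0 -> t.2 e
                       & chart t.1 (comb a t.1 l) = x]].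
have DP d : Gamma a w d -> exists t, D t = d.
  move=> [c [F [fF Fb ->]]].
  exists (c, [ffun e => `[< F (gen c e) >]]); apply/seteqP; split=> x /=.
    move=> [l [lc lF <-]]; apply: (Gamma_lift (h := wt l)).
    by apply/(face_lift_of fF lc) => e /lF; rewrite ffunE => /asboolP.
  move=> [z Fz <-]; have /lifted_coneP[l lc zE] := face_sub fF Fz.
  exists l; split=> //; last by rewrite zE row_mxKl.
  move=> e le; rewrite ffunE; apply/asboolP.
  by apply: (face_lift_of fF lc).1 le; rewrite -zE.
move=> Gd0; have [t0 Et0] := DP _ Gd0.
have [|||t [Gt le tmax]] := @finite_maximal _ (fun s t => D s `<=` D t)
    (fun t => Gamma a w (D t)) t0.
- by move=> t.
- by move=> t2 t1 t3; apply: subset_trans.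
- by rewrite Et0.
exists (D t); last by rewrite -Et0.
split=> // d' Gd' td'; have [t' Et'] := DP _ Gd'.
apply/seteqP; split=> //; rewrite -Et'; apply: tmax; by rewrite Et'.
Qed.

Lemma N_monoidE c d u : N_monoid a w c d u <->
  exists2 m : 'X_{1..n}, forall e, m e != 0%N ->
               [/\ pts c (val (a e)), d (val (a e))
                 & is_height a w (val (a e)) (w e)%:R]
           & u = comb a c (exponent m).
Proof.
rewrite /N_monoid (_ : [set _ | _] = [set v | exists2 e,
    [/\ pts c (val (a e)), d (val (a e))
      & is_height a w (val (a e)) (w e)%:R] & v = coord a c e]); last first.
  apply/seteqP; split=> v /= [e].
    move=> [[Cv dv] Ev he]; exists e; last by rewrite (coordE Cv Ev).
    by split=> //; rewrite -Ev //; apply: chart_pts.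
  move=> [ce de he] ->; exists e; split=> //; last exact: chart_coord.
  by split; [apply: cone_coord|rewrite /= chart_coord].
split=> [/monoid_hull_family[m me ->]|[m me ->]].
  exists [multinom m e | e < n]; first by move=> e; rewrite mnmE => /me.
  by apply: eq_bigr => e _; rewrite /exponent mnmE scaler_nat.
apply/monoid_hull_family; exists m => //.
by apply: eq_bigr => e _; rewrite /exponent scaler_nat.
Qed.

Lemma coeffs_on_exponent c m :
  (forall e, m e != 0%N -> pts c (val (a e))) -> coeffs_on a c (exponent m).
Proof.
by move=> mc; split=> e; rewrite ?exponent_neq0 ?ler0n //; apply: mc.
Qed.

Lemma N_monoid_represents (c : face S) F m :
    is_face (lifted_cone a w c) F -> F `<=` bottom a w c ->
    (forall e, m e != 0%N -> [set chart c (lsubmx z) | z in F] (val (a e)) /\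
                             is_height a w (val (a e)) (w e)%:R) ->
  coeffs_on a c (exponent m) /\
  F (at_height (comb a c (exponent m)) (wdeg w m)%:R).
Proof.
move=> fF Fb me.
have mc : coeffs_on a c (exponent m).
  by apply: coeffs_on_exponent => e /me[/(Gamma_sub fF Fb)].
split=> //; rewrite -wt_exponent; apply/(face_lift_of fF mc) => e.
by rewrite exponent_neq0 => /me[de he]; apply: Gamma_gen.
Qed.

(** Normality at a facet gives each point of |M| in it a representative supported on a face of the
    bottom; its weight is the height, so minimal representatives have this weight too. Conversely, a
    minimal representative whose weight is the height lifts into [F], and extremality puts all its
    generators there. *)
Lemma normality_iff_min_height :
  (forall d : set X, Gamma_facet a w d ->
   forall c : face S, smallest_face d c ->
     N_monoid a w c d = mon M c `&` (cone c `&` chart c @^-1` d)) <->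
  (forall m x, min_represents m x -> is_height a w x (wdeg w m)%:R).
Proof.
split=> [normal m x [mx mmin]|height d [Gd _] c [dc cmin]].
  have [c [u [Mu Cu Eu]]] := represents_cone mx.
  have [h low] := lowest_exists ha w Cu.
  have [F0 [fF0 F0b F0u]] := lowest_face low.
  have [d dfacet d0d] := Gamma_facet_above (Gamma_face fF0 F0b).
  have dx : d x by rewrite -Eu; apply/d0d/(Gamma_lift F0u).
  have [[c1 [F [fF Fb dE]]] _] := dfacet.
  have [|c2 sm] := @smallest_face_exists _ _ S d c1.
    by rewrite dE; apply: Gamma_sub.
  have [_ _ /(_ x)[|v Cv Ev]] := chart_bij c2; first exact: sm.1.
  have [mc2 mv] := represents_at mx Cv Ev.
  have : N_monoid a w c2 d v.
    rewrite (normal _ dfacet _ sm); split; last by split=> //=; rewrite Ev.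
    by apply/(mon_comb ha); exists m => //; rewrite -mv.
  move=> /N_monoidE[m' m'd vE].
  have m'x : represents m' x.
    exists c2; rewrite -vE; split=> //.
    by apply: coeffs_on_exponent => e /m'd[].
  have [|m'c1 Fm'] := @N_monoid_represents c1 F m' fF Fb.
    by move=> e /m'd[_ de he]; rewrite -dE.
  have xE : chart c1 (comb a c1 (exponent m')) = x.
    by apply: represents_uniq m'x; exists c1.
  have Cm' := cone_comb m'c1.
  have low' := face_lowest Fb Fm'.
  have wm : wdeg w m = wdeg w m'.
    apply/eqP; rewrite eqn_leq mmin //= -(ler_nat R).
    exact: lowest_le_wdeg mx xE Cm' low'.
  by rewrite wm -xE; apply/(is_heightE _ _ _ Cm').
have [c0 [F [fF Fb dE]]] := Gd.
have cc0 : pts c `<=` pts c0 by apply: cmin; rewrite dE; apply: Gamma_sub.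
apply/seteqP; split=> u.
  move=> /N_monoidE[m md ->].
  have mc : coeffs_on a c (exponent m).
    by apply: coeffs_on_exponent => e /md[].
  have [|mc0 Fm] := @N_monoid_represents c0 F m fF Fb.
    by move=> e /md[_ de he]; rewrite -dE.
  split; first by apply/(mon_comb ha); exists m.
  split; first exact: cone_comb.
  rewrite /= (@represents_uniq m (chart c (comb a c (exponent m)))
    (chart c0 (comb a c0 (exponent m)))).
  - by rewrite dE; apply: (Gamma_lift Fm).
  - by exists c.
  - by exists c0.
move=> [Mu [Cu du]]; apply/N_monoidE.
have [m0 m0u] := represents_exists Mu.
have [m /[dup] mmin [mu _]] := min_represents_exists m0u.
have [mc mE] := represents_at mu Cu erefl.
exists m => // e me.
have ce : pts c (val (a e)) by apply: mc.2; rewrite exponent_neq0.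
have := du; rewrite /= dE => /Gamma_at[//|//|v [h [Cv Ev Fv low]]].
have [mc0 mv] := represents_at mu Cv Ev.
have := height _ _ mmin; rewrite -Ev.
move=> /(is_heightE _ _ _ Cv)/(lowest_uniq low) hE.
have Fe : F (gen c0 e).
  apply: (face_lift_of fF mc0).1; last by rewrite exponent_neq0.
  by rewrite wt_exponent mv -hE.
have [] := gen_Gamma Fb (cc0 _ ce) Fe.
by rewrite -dE.
Qed.

End Subdivision.

Arguments exponent {R n} m e.

(** * The initial ideal *)

Section CoefficientSums.
Variables (K : fieldType) (n : nat).
Implicit Types (f g : {mpoly K[n]}) (P : pred 'X_{1..n}).

(** Both ideals are common kernels of such functionals, with [P] selecting the representatives, or
    the minimal ones, of a point. *)
Definition coeff_sum P f : K := \sum_(m <- msupp f | P m) f@_m.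

Lemma coeff_sumwE P k f : (msize f <= k)%N ->
  coeff_sum P f = \sum_(m : 'X_{1..n < k} | P m) f@_m.
Proof.
move=> fk; pose I : subFinType _ := 'X_{1..n < k}.
rewrite /coeff_sum (big_mksub_cond I) //=; first last.
- by move=> x /msize_mdeg_lt /leq_trans /(_ fk) ->.
- exact: msupp_uniq.
rewrite -big_filter_cond big_rmcond ?big_filter //=.
by move=> m /memN_msupp_eq0.
Qed.

Lemma coeff_sum_is_linear P : linear (coeff_sum P : {mpoly K[n]} -> K^o).
Proof.
move=> c f g; pose k := maxn (msize (c *: f + g)) (maxn (msize f) (msize g)).
rewrite !(@coeff_sumwE P k) ?leq_max ?leqnn ?orbT //.
rewrite scaler_sumr -big_split; apply: eq_bigr => m _ /=.
by rewrite mcoeffD mcoeffZ.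
Qed.

HB.instance Definition _ P :=
  GRing.isLinear.Build K {mpoly K[n]} K^o _ (coeff_sum P)
    (@coeff_sum_is_linear P).

Lemma coeff_sum_sum P (I : Type) (r : seq I) (Q : pred I)
    (F : I -> {mpoly K[n]}) :
  coeff_sum P (\sum_(i <- r | Q i) F i) = \sum_(i <- r | Q i) coeff_sum P (F i).
Proof. exact: (linear_sum (coeff_sum P)). Qed.

Lemma coeff_sumZ P c f : coeff_sum P (c *: f) = c * coeff_sum P f.
Proof. by rewrite linearZ. Qed.

Lemma coeff_sumB P f g : coeff_sum P (f - g) = coeff_sum P f - coeff_sum P g.
Proof. exact: (linearB (coeff_sum P)). Qed.

Lemma coeff_sumX P m : coeff_sum P 'X_[m] = (P m)%:R.
Proof.
rewrite /coeff_sum msuppX big_mkcond /= big_seq1 mcoeffX eqxx.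
by case: (P m).
Qed.

Lemma coeff_sumXM P q f :
  coeff_sum P ('X_[q] * f) = coeff_sum (fun m => P (q + m)%MM) f.
Proof.
rewrite [in LHS](mpolyE f) mulr_sumr coeff_sum_sum.
rewrite [RHS]/coeff_sum [RHS]big_mkcond; apply: eq_bigr => m _.
rewrite -scalerAr -mpolyXD coeff_sumZ coeff_sumX.
by case: (P _); rewrite ?mulr1 ?mulr0.
Qed.

Lemma coeff_sum_pihomog P (w : 'I_n -> nat) D f :
  coeff_sum P (pihomog (wdeg w) D f) =
  coeff_sum (fun m => P m && (wdeg w m == D)) f.
Proof.
rewrite pihomogE coeff_sum_sum [RHS]/coeff_sum.
rewrite [LHS]big_mkcond [RHS]big_mkcond; apply: eq_bigr => m _.
rewrite coeff_sumZ coeff_sumX.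
by case: (P m); case: eqP; rewrite ?mulr1 ?mulr0.
Qed.

Lemma initial_component_leading w D f m0 :
  (forall m, m \in msupp f -> (wdeg w m <= D)%N) ->
  m0 \in msupp f -> wdeg w m0 = D ->
  initial_component w f = pihomog (wdeg w) D f.
Proof.
move=> fD fm0 m0D; rewrite /initial_component.
suff -> : mmeasure (wdeg w) f = D.+1 by [].
apply/eqP; rewrite eqn_leq -{2}m0D mmeasure_mnm_lt // andbT mmeasureE.
by rewrite big_seq; elim/big_ind: _ => // x y xD yD; rewrite geq_max xD.
Qed.

Lemma initial_component_homog w D f :
  (forall m, m \in msupp f -> wdeg w m = D) -> initial_component w f = f.
Proof.
move=> fD; have [->|f0] := eqVneq f 0.
  by rewrite /initial_component pihomog0.
have : msupp f != [::] by rewrite msupp_eq0.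
case E : (msupp f) => [//|m0 s] _.
have fm0 : m0 \in msupp f by rewrite E mem_head.
rewrite (@initial_component_leading w D f m0) //.
- by apply: pihomog_dE; apply/dhomogP.
- by move=> m /fD ->.
- exact: fD.
Qed.

End CoefficientSums.

Section IdealHull.
Variables (A : comNzRingType) (G : set A).

Lemma ideal_hull0 : ideal_hull G 0.
Proof.
by exists 0%N, (fun=> 0), (fun=> 0); split=> [[]//|]; rewrite big_ord0.
Qed.

Lemma ideal_hull_gen x : G x -> ideal_hull G x.
Proof.
move=> Gx; exists 1%N, (fun=> 1), (fun=> x).
by split; rewrite // big_ord1 mul1r.
Qed.

Lemma ideal_hullD x y :
  ideal_hull G x -> ideal_hull G y -> ideal_hull G (x + y).
Proof.
move=> [k [l [v [Gv ->]]]] [k' [l' [v' [Gv' ->]]]].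
exists (k + k')%N,
  (fun i => match fintype.split i with inl j => l j | inr j => l' j end),
  (fun i => match fintype.split i with inl j => v j | inr j => v' j end).
split=> [i|]; first by case: (fintype.split i).
rewrite big_split_ord; congr (_ + _); apply: eq_bigr => i _.
  by rewrite (unsplitK (inl i : 'I_k + 'I_k')).
by rewrite (unsplitK (inr i : 'I_k + 'I_k')).
Qed.

Lemma ideal_hullM x y : ideal_hull G y -> ideal_hull G (x * y).
Proof.
move=> [k [l [v [Gv ->]]]]; exists k, (fun i => x * l i), v; split=> //.
by rewrite mulr_sumr; apply: eq_bigr => i _; rewrite mulrA.
Qed.

Lemma ideal_hull_sum (I : Type) (r : seq I) (P : pred I) (F : I -> A) :
  (forall i, P i -> ideal_hull G (F i)) ->
  ideal_hull G (\sum_(i <- r | P i) F i).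
Proof.
move=> GF; apply: (big_ind (ideal_hull G)) => //; first exact: ideal_hull0.
exact: ideal_hullD.
Qed.

End IdealHull.

Lemma mnm_ind n (P : 'X_{1..n} -> Prop) :
  P 0%MM -> (forall e m, P m -> P (U_(e) + m)%MM) -> forall m, P m.
Proof.
move=> P0 PU m; move: {2}(mdeg m) (erefl (mdeg m)) => k.
elim: k m => [|k IH] m mk.
  by have /eqP -> : m == 0%MM by rewrite -mdeg_eq0 mk.
have : m != 0%MM by rewrite -mdeg_eq0 mk.
move=> /eqP nz; have [e me] : exists e, m e != 0%N.
  apply: contrapT => H; apply: nz; apply/mnmP => e; rewrite mnm0E.
  by apply/eqP; apply: contrapT => /negP me; apply: H; exists e.
have Um : (U_(e) <= m)%MM by rewrite lep1mP.
rewrite -(submK Um) addmC; apply/PU/IH.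
by move: mk; rewrite -{1}(submK Um) mdegD mdeg1 addn1 => -[].
Qed.

(** * Membership in the toric ideal and in its initial ideal *)

Section ToricIdeal.
Variables (K : fieldType) (R : realType) (X : choiceType).
Variables (S : conicalComplex R X) (M : monoidalComplex S).
Variables (n : nat) (a : 'I_n -> monsupp M).
Implicit Types (c d : face S) (m q : 'X_{1..n}) (f g : {mpoly K[n]}).

Local Notation represents := (represents a).

Lemma exponentD m q :
  exponent (m + q) = exponent m \+ exponent q :> ('I_n -> R).
Proof. by apply/funext => e; rewrite /exponent mnmDE natrD. Qed.

Lemma exponent0 : exponent (0%MM : 'X_{1..n}) = (fun=> 0) :> ('I_n -> R).
Proof. by apply/funext => e; rewrite /exponent mnm0E. Qed.

Lemma comb_exponentD c m q :
  comb a c (exponent (m + q)) = comb a c (exponent m) + comb a c (exponent q).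
Proof.
rewrite exponentD /comb -big_split; apply: eq_bigr => e _ /=.
by rewrite scalerDl.
Qed.

Lemma coeffs_on_exponentD c m q : coeffs_on a c (exponent (m + q)) <->
  coeffs_on a c (exponent m) /\ coeffs_on a c (exponent q).
Proof.
split=> [[_ mq]|[[_ mc] [_ qc]]].
  split; split=> e; rewrite ?ler0n // exponent_neq0 => e0; apply: mq;
  by rewrite exponent_neq0 mnmDE addn_eq0 negb_and e0 ?orbT.
split=> e; rewrite ?ler0n // exponent_neq0 mnmDE addn_eq0 negb_and => /orP[] e0.
  by apply: mc; rewrite exponent_neq0.
by apply: qc; rewrite exponent_neq0.
Qed.

Lemma comb_exponentU c e : comb a c (exponent U_(e)) = coord a c e.
Proof.
rewrite /comb (bigD1 e) //= /exponent mnm1E eqxx scale1r big1 ?addr0 // => i ie.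
by rewrite mnm1E eq_sym (negPf ie) scale0r.
Qed.

Lemma coeffs_on_exponentU c e :
  coeffs_on a c (exponent U_(e)) <-> pts c (val (a e)).
Proof.
split=> [[_]|ce]; first by apply; rewrite exponent_neq0 mnm1E eqxx.
split=> i; rewrite ?ler0n // exponent_neq0 mnm1E.
by have [<-|] := eqVneq e i.
Qed.

Hypothesis ha : generating_family a.

Lemma mon_comb_exponent c m : coeffs_on a c (exponent m) ->
  mon M c (comb a c (exponent m)).
Proof. by move=> mc; apply/(mon_comb ha); exists m. Qed.

Definition toric_monomial m : toricRing K M :=
  \prod_(e < n) tmon K (a e) ^+ m e.

Lemma toric_monomialU e m :
  toric_monomial (U_(e) + m)%MM = tmon K (a e) * toric_monomial m.
Proof.
rewrite /toric_monomial (bigD1 e) //= [in RHS](bigD1 e) //=.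
rewrite mnmDE mnm1E eqxx exprS mulrA; congr (_ * _).
apply: eq_bigr => i ie.
by rewrite mnmDE mnm1E eq_sym (negPf ie).
Qed.

(** Induction on the degree: multiplying by one more variable is nonzero exactly when both factors
    have exponents in a common [M_c]. *)
Lemma toric_monomialP m :
  (exists2 z, represents m (val z) & toric_monomial m = tmon K z) \/
  ((forall x, ~ represents m x) /\ toric_monomial m = 0).
Proof.
elim/mnm_ind: m => [|e m IH].
  rewrite /toric_monomial big1 => [|e _]; last by rewrite mnm0E expr0.
  (* The unit is 0 if the complex has no faces; then no point is represented either. *)
  rewrite /GRing.one /= /tone; case: pickP => [c _|no].
    left; exists (SigSub (monsupp0 M c)) => //=; exists c.
    rewrite exponent0; split; last first.
      by rewrite /comb big1 // => e _; rewrite scale0r.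
    by split=> e //; rewrite eqxx.
  by right; split=> // x [c _]; have := no c.
rewrite toric_monomialU.
case: IH => [[z mz ->]|[nm ->]]; last first.
  right; split; last exact: mulr0.
  move=> x [c [/coeffs_on_exponentD[_ mc] _]].
  by apply: (nm (chart c (comb a c (exponent m)))); exists c.
rewrite {1 2}/GRing.mul /=; case: tmulP => [t [c [u [v [Mu Mv Eu Ev Et]]]]|no].
  left; exists t => //; have [mc mv] := represents_at mz (mon_in_cone Mv) Ev.
  exists c; rewrite comb_exponentD comb_exponentU mv.
  rewrite (coordE (mon_in_cone Mu) Eu) Et; split=> //.
  apply/coeffs_on_exponentD; split=> //; apply/coeffs_on_exponentU.
  by rewrite -Eu; apply/chart_pts/(mon_in_cone Mu).
right; split=> // x [c [/coeffs_on_exponentD[/coeffs_on_exponentU ce mc] _]].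
apply: (no (chart c (coord a c e + comb a c (exponent m)))).
exists c, (coord a c e), (comb a c (exponent m)); split=> //.
- exact: mon_coord.
- exact: mon_comb_exponent.
- exact: chart_coord.
- by apply: (represents_uniq _ mz); exists c.
Qed.

Lemma coeff_toric_map x f :
  coeff x (toric_map K a f) =
  coeff_sum (fun m => `[< represents m (val x) >]) f.
Proof.
rewrite /toric_map raddf_sum /coeff_sum [RHS]big_mkcond; apply: eq_bigr => m _.
rewrite /= coeffZ -/(toric_monomial m).
case: asboolP => mx; case: (toric_monomialP m) => [[z mz ->]|[nm ->]].
- by rewrite coeffU (val_inj (represents_uniq mz mx)) eqxx !mulr1.
- by case: (nm _ mx).
- rewrite coeffU mul1r; case: eqP => [zx|_]; last by rewrite mulr0.
  by case: mx; rewrite -zx.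
- by rewrite coeff0 mulr0.
Qed.

Lemma represents_monsupp m x : represents m x -> x \in monsupp M.
Proof.
move=> /(represents_cone ha)[c [u [Mu _ <-]]].
by apply/mem_set; exists c => //; exists u.
Qed.

Lemma toric_idealP f : toric_ideal K a f <->
  forall x, coeff_sum (fun m => `[< represents m x >]) f = 0.
Proof.
split=> [f0 x|f0].
  have [Mx|nMx] := boolP (x \in monsupp M).
    by have := coeff_toric_map (SigSub Mx) f; rewrite f0 coeff0 => <-.
  apply: big1_seq => m /andP[/asboolP mx _].
  by rewrite (represents_monsupp mx) in nMx.
apply/eqP/freeg_eqP => x; rewrite coeff0.
by rewrite coeff_toric_map.
Qed.

Variable w : 'I_n -> nat.
Local Notation min_represents := (min_represents a w).
Local Notation J := (initial_ideal w (toric_ideal K a)).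
Local Notation min_sum x f :=
  (coeff_sum (fun m => `[< min_represents m x >]) f).

Lemma representsD m q x y m' : represents (q + m)%MM x -> represents m y ->
  represents (q + m')%MM x <-> represents m' y.
Proof.
move=> [c [qmc <-]] my; have /coeffs_on_exponentD[qc mc] := qmc.
have <- : chart c (comb a c (exponent m)) = y.
  by apply: (represents_uniq _ my); exists c.
have Cm := cone_comb mc; have Cqm := cone_comb qmc.
split=> [/represents_at/(_ Cqm erefl)|/represents_at/(_ Cm erefl)].
  rewrite !comb_exponentD => -[/coeffs_on_exponentD[_ m'c] /addrI E].
  by exists c; rewrite E.
by move=> [m'c E]; exists c; rewrite !comb_exponentD E coeffs_on_exponentD.
Qed.

(** If a top-weight monomial [m] of [f], shifted by [q], represents [x] minimally, then all
    monomials of [f] representing the same point [y] as [m] have top weight. The sum is then the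
    full coefficient sum of [f] at [y]. If there is no such [m], the sum is empty. *)
Lemma min_sum_initial f q x : toric_ideal K a f ->
  min_sum x ('X_[q] * initial_component w f) = 0.
Proof.
move=> /toric_idealP f0; rewrite coeff_sumXM coeff_sum_pihomog.
set D := (mmeasure _ f).-1.
have fD m : m \in msupp f -> (wdeg w m <= D)%N.
  move=> /(@mmeasure_mnm_lt _ _ (wdeg w)); rewrite -/D /D.
  by case: mmeasure.
have [[m [fm] /andP[/asboolP[qmx qmin] /eqP mD]]|no] := pselect (exists m,
    m \in msupp f /\ `[< min_represents (q + m)%MM x >] && (wdeg w m == D)).
  have [y my] : exists y, represents m y.
    have [c [/coeffs_on_exponentD[_ mc] _]] := qmx.
    by exists (chart c (comb a c (exponent m))), c.
  rewrite -(f0 y) /coeff_sum big_seq_cond [RHS]big_seq_cond.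
  apply: eq_bigl => m'; have [fm'|//] := boolP (m' \in msupp f).
  rewrite /=; apply/andP/asboolP.
    by move=> [/asboolP[/(representsD m' qmx my)]].
  move=> m'y.
  have qm'x := (representsD m' qmx my).2 m'y.
  have m'D : wdeg w m' = D.
    apply/eqP; rewrite eqn_leq fD //= -mD -(leq_add2l (wdeg w q)).
    by rewrite -!wdegD; apply: qmin.
  rewrite m'D; split=> //; apply/asboolP; split=> // m'' /qmin.
  by rewrite !wdegD m'D mD.
by apply: big1_seq => m /andP[Pm fm]; case: no; exists m.
Qed.

Lemma min_sum_initial_ideal f x : J f -> min_sum x f = 0.
Proof.
move=> [k [l [v [Gv ->]]]].
rewrite coeff_sum_sum.
apply: big1 => i _; have [g Ig <-] := Gv i.
rewrite (mpolyE (l i)) mulr_suml coeff_sum_sum.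
apply: big1 => m _ /=; rewrite -scalerAl coeff_sumZ.
by rewrite min_sum_initial // mulr0.
Qed.

Lemma toric_ideal_sub m m' x : represents m x -> represents m' x ->
  toric_ideal K a ('X_[m] - 'X_[m']).
Proof.
move=> mx m'x; apply/toric_idealP => y; rewrite coeff_sumB !coeff_sumX.
suff -> : `[< represents m y >] = `[< represents m' y >] by rewrite subrr.
apply/asbool_equiv_eq; split=> [my|m'y].
  by rewrite (represents_uniq my mx).
by rewrite (represents_uniq m'y m'x).
Qed.

(** Given a lighter representative [m'] of the same point, ['X_[m]] is the initial component of
    ['X_[m] - 'X_[m']]; a monomial representing nothing is itself in the toric ideal. *)
Lemma initial_ideal_nonmin m : ~ (exists x, min_represents m x) -> J 'X_[m].
Proof.
move=> nm; apply: ideal_hull_gen.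
have [[x mx]|nr] := pselect (exists x, represents m x).
  have [m' m'x lt] : exists2 m', represents m' x & (wdeg w m' < wdeg w m)%N.
    apply: contrapT => H; apply: nm; exists x; split=> // m' m'x.
    by rewrite leqNgt; apply/negP => lt; apply: H; exists m'.
  exists ('X_[m] - 'X_[m']); first exact: toric_ideal_sub mx m'x.
  rewrite (@initial_component_leading _ _ _ (wdeg w m) _ m) //.
  - by rewrite linearB /= !pihomogX eqxx (ltn_eqF lt) subr0.
  - move=> q /msuppB_le; rewrite mem_cat !msuppX !mem_seq1.
    by move=> /orP[/eqP->|/eqP->] //; apply: ltnW.
  - rewrite mcoeff_msupp mcoeffB !mcoeffX eqxx.
    have [E|_] := eqVneq m' m; first by rewrite E ltnn in lt.
    by rewrite subr0 oner_eq0.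
exists 'X_[m].
  apply/toric_idealP => x; rewrite coeff_sumX.
  by case: asboolP => // mx; case: nr; exists x.
apply: (@initial_component_homog _ _ _ (wdeg w m)) => q.
by rewrite msuppX mem_seq1 => /eqP ->.
Qed.

Lemma initial_idealP f : J f <-> forall x, min_sum x f = 0.
Proof.
split=> [Jf x|f0]; first exact: min_sum_initial_ideal.
pose mu x := xget (0%MM : 'X_{1..n}) [set m | min_represents m x].
pose P m := `[< exists x, min_represents m x >].
have [v vP] : exists v : 'X_{1..n} -> option X, forall m x,
    min_represents m x <-> v m = Some x.
  exists (fun m => if pselect (exists x, min_represents m x) is left H
                   then Some (projT1 (cid H)) else None) => m x.
  case: pselect => [H|H]; last by split=> // mx; case: H; exists x.
  case: cid => y /= my; split=> [mx|[<-]//].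
  by rewrite (represents_uniq my.1 mx.1).
pose h (o : option X) : {mpoly K[n]} := if o is Some x then 'X_[mu x] else 0.
(* Subtracting this vanishing sum replaces each minimal monomial of [f] by its difference from the
   chosen one over the same point, a weight-homogeneous binomial of the toric ideal. *)
have E : \sum_(m <- msupp f | P m) (f@_m)%:MP * h (v m) = 0.
  apply: sum_regroup => -[x|].
    rewrite -[RHS](mpolyC0 n K) -(f0 x) /coeff_sum rmorph_sum /=.
    apply: eq_bigl => m; apply/andP/asboolP => [[_ /eqP/vP]//|mx].
    by split; [apply/asboolP; exists x|apply/eqP/vP].
  apply: big1 => m /andP[/asboolP[x /vP ->]//].
rewrite -[f]subr0 -E {1}(mpolyE f) (bigID P) /= addrAC -sumrB.
apply: ideal_hullD; apply: ideal_hull_sum => m; last first.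
  move=> /asboolP nm; rewrite -mul_mpolyC; apply: ideal_hullM.
  exact: initial_ideal_nonmin.
move=> /asboolP[x mx]; have /vP vm := mx.
rewrite -mul_mpolyC -mulrBr vm; apply/ideal_hullM/ideal_hull_gen.
have mux : min_represents (mu x) x.
  by rewrite /mu; case: xgetP => [q -> //|/(_ m)].
exists ('X_[m] - 'X_[mu x]); first exact: toric_ideal_sub mx.1 mux.1.
apply: (@initial_component_homog _ _ _ (wdeg w m)) => q /msuppB_le.
rewrite mem_cat !msuppX !mem_seq1 => /orP[/eqP ->//|/eqP ->].
by apply/eqP; rewrite eqn_leq (mux.2 _ mx.1) (mx.2 _ mux.1).
Qed.

End ToricIdeal.

(** * Reducedness *)

Section TorsionFreeGrading.
Variables (K : fieldType) (n r : nat).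
Variables (T : pred 'I_n) (z : 'I_n -> 'rV[int]_r).
Implicit Types (m : 'X_{1..n}) (f g : {mpoly K[n]}).

Definition supported_in m := [forall e, (m e != 0%N) ==> T e].

Definition degree_in m : 'rV[int]_r := \sum_e z e *+ m e.

Definition in_degree v m := supported_in m && (degree_in m == v).

(** The linear form with coefficients [1, B, B^2, ...]. *)
Definition int_form (B : nat) (v : 'rV[int]_r) : int := (rVpoly v).[B%:Z].

Lemma int_form_is_additive B : additive (int_form B).
Proof. by move=> u v; rewrite /int_form raddfB /= hornerD hornerN. Qed.

HB.instance Definition _ B := GRing.isZmodMorphism.Build _ _ (int_form B)
  (int_form_is_additive B).

(** The nonzero differences, read as polynomials, have a nonzero product, which has finitely many
    roots; any natural number that is not a root serves as [B]. *)
Lemma int_form_separates (s : seq 'rV[int]_r) :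
  exists B, {in s &, injective (int_form B)}.
Proof.
pose p : {poly int} :=
  \prod_(q <- [seq x - y | x <- s, y <- s] | q != 0) rVpoly q.
have rV0 (q : 'rV[int]_r) : (rVpoly q == 0) = (q == 0).
  apply/eqP/eqP => [q0|->]; last by rewrite raddf0.
  by rewrite -[q]rVpolyK q0 raddf0.
have p0 : p != 0.
  by rewrite /p; elim/big_ind: _ => [|x y x0 y0|q q0];
     rewrite ?oner_eq0 ?mulf_neq0 ?rV0.
have [B pB] : exists B : nat, p.[B%:Z] != 0.
  apply: contrapT => H.
  have uq : uniq [seq B%:Z | B <- iota 0 (size p)].
    by rewrite map_inj_uniq ?iota_uniq // => x y [].
  have : all (root p) [seq B%:Z | B <- iota 0 (size p)].
    apply/allP => _ /mapP[B _ ->]; apply/rootP; apply: contrapT => /eqP nz.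
    by apply: H; exists B.
  by move=> /(max_poly_roots p0)/(_ uq); rewrite size_map size_iota ltnn.
exists B => x y sx sy E; apply/eqP; rewrite -subr_eq0.
apply: contraNT pB => xy0; rewrite horner_prod prodf_seq_eq0.
apply/hasP; exists (x - y); first exact: allpairs_f.
by rewrite xy0 /= -/(int_form B (x - y)) raddfB /= E subrr.
Qed.

Local Notation L := {fraction {poly K}}.
Local Notation t := (tofrac 'X : L).
Local Notation scalar := (@tofrac {poly K} \o polyC).

Definition toric_var B e : L := if T e then t ^ int_form B (z e) else 0.

Lemma t_neq0 : t != 0.
Proof. by rewrite tofrac_eq0 polyX_eq0. Qed.

Lemma mmap1_toric_var B m : mmap1 (toric_var B) m =
  if supported_in m then t ^ int_form B (degree_in m) else 0.
Proof.
rewrite /mmap1; case: ifPn => [/forallP mT|].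
  rewrite raddf_sum (big_morph _ (fun i j => expfzDr i j t_neq0) (expr0z _)).
  apply: eq_bigr => e _; rewrite raddfMn /= -mulr_natr natz -exprz_exp -exprnP.
  rewrite /toric_var; have := mT e; case: eqP => /= [->|_ ->] //.
rewrite negb_forall => /existsP[e]; rewrite negb_imply => /andP[me Te].
by rewrite (bigD1 e) //= /toric_var (negPf Te) expr0n (negPf me) mul0r.
Qed.

Lemma mmap_toric_varE B f : mmap scalar (toric_var B) f =
  \sum_(m <- msupp f | supported_in m)
     scalar f@_m * t ^ int_form B (degree_in m).
Proof.
rewrite /mmap [RHS]big_mkcond; apply: eq_bigr => m _.
by rewrite mmap1_toric_var; case: ifP; rewrite ?mulr0.
Qed.

Lemma mmap_toric_var_eq0 B f : (forall v, coeff_sum (in_degree v) f = 0) ->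
  mmap scalar (toric_var B) f = 0.
Proof.
move=> f0; rewrite mmap_toric_varE.
apply: (@sum_regroup _ _ _ _ _ degree_in (fun m => scalar f@_m)
         (fun v => t ^ int_form B v)) => v.
rewrite -rmorph_sum /=; have := f0 v.
by rewrite /coeff_sum /in_degree => ->; rewrite rmorph0.
Qed.

(** Distinct degrees in [f] give distinct powers of [t], so each coefficient of the image is a
    single coefficient sum. *)
Lemma coeff_sum_eq0 B f :
  {in map degree_in (msupp f) &, injective (int_form B)} ->
  mmap scalar (toric_var B) f = 0 -> forall v, coeff_sum (in_degree v) f = 0.
Proof.
move=> inj; rewrite mmap_toric_varE => f0 v.
have [[m0 fm0 /andP[m0T /eqP m0v]]|no] :=
  pselect (exists2 m, m \in msupp f & in_degree v m); last first.
  by apply: big1_seq => m /andP[mv fm]; case: no; exists m.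
(* Multiplying by [t ^ N] makes all exponents non-negative, so coefficients can be compared in
   [{poly K}]. *)
pose N := (\sum_(m <- msupp f) `|int_form B (degree_in m)|)%N.
pose k m := int_form B (degree_in m) + N%:Z.
have k0 m : m \in msupp f -> 0 <= k m.
  move=> fm; rewrite /k /N (big_rem m) //= PoszD abszE.
  by rewrite addrA addr_ge0 // -lerBlDl sub0r -normrN ler_norm.
pose p : {poly K} := \sum_(m <- msupp f | supported_in m) f@_m *: 'X^`|k m|.
have p0 : p = 0.
  apply/eqP; rewrite -tofrac_eq0; apply/eqP.
  rewrite -[RHS](mul0r (t ^ N)) -f0 mulr_suml rmorph_sum /=.
  rewrite [LHS]big_seq_cond [RHS]big_seq_cond; apply: eq_bigr => m /andP[fm _].
  rewrite -mul_polyC rmorphM rmorphXn -mulrA -expfzDr ?t_neq0 //; congr (_ * _).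
  by rewrite -/(k m) -[in RHS](gez0_abs (k0 _ fm)).
have := congr1 (fun q : {poly K} => q`_`|k m0|) p0.
rewrite coef0 coef_sum => <-; rewrite /coeff_sum.
rewrite [LHS]big_seq_cond [RHS]big_seq_cond [LHS]big_mkcond [RHS]big_mkcond.
apply: eq_bigr => m _; rewrite /in_degree coefZ coefXn.
case: (boolP (m \in msupp f)) => //= fm; case: (supported_in m) => //=.
have -> : (`|k m0| == `|k m|)%N = (degree_in m == v).
  rewrite -eqz_nat !gez0_abs ?k0 // /k.
  rewrite (inj_eq (addIr _)) eq_sym -m0v; apply/eqP/eqP => [E|-> //].
  by apply: inj => //; apply: map_f.
by case: eqP; rewrite ?mulr1 ?mulr0.
Qed.

(** The image of [g ^+ k] vanishes for every [B], so it suffices to separate the degrees of [g]: its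
    image lies in a field and is then 0. *)
Lemma coeff_sum_nilpotent g k :
  (forall v, coeff_sum (in_degree v) (g ^+ k) = 0) ->
  forall v, coeff_sum (in_degree v) g = 0.
Proof.
move=> gk0; have [B inj] := int_form_separates (map degree_in (msupp g)).
apply: (coeff_sum_eq0 inj); apply/eqP.
have /eqP := mmap_toric_var_eq0 B gk0.
by rewrite rmorphXn expf_eq0 => /andP[_].
Qed.

End TorsionFreeGrading.

Section Radical.
Variables (K : fieldType) (R : realType) (X : choiceType).
Variables (S : conicalComplex R X) (M : monoidalComplex S).
Variables (n : nat) (a : 'I_n -> monsupp M).
Hypothesis ha : generating_family a.
Variable w : 'I_n -> nat.
Implicit Types (m : 'X_{1..n}).

Local Notation J := (initial_ideal w (toric_ideal K a)).

Lemma wdegMn m N : wdeg w (m *+ N)%MM = (N * wdeg w m)%N.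
Proof.
by rewrite /wdeg big_distrr; apply: eq_bigr => e _; rewrite mulmnE mulnAC mulnC.
Qed.

Lemma min_height_of_radical : radical_ideal J ->
  forall m x, min_represents a w m x -> is_height a w x (wdeg w m)%:R.
Proof.
move=> radJ m x [mx mmin].
have [c [u [Mu Cu Eu]]] := represents_cone ha mx.
have [h low] := lowest_exists ha w Cu.
have := lowest_le_wdeg mx Eu Cu low; rewrite le_eqVlt => /predU1P[hm|hm].
  by rewrite -Eu; apply/(is_heightE _ _ _ Cu); rewrite -hm.
have [N [q [qc qE qlt]]] := lowest_rational ha Mu low hm.
have [mc mE] := represents_at mx Cu Eu.
pose m' := [multinom q e | e < n].
have m'E : exponent m' = (fun e => (q e)%:R) :> ('I_n -> R).
  by apply/funext => e; rewrite /exponent mnmE.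
(* [m'] represents the same point as [m *+ N] with smaller weight, so the latter is not minimal. *)
have XmN : J ('X_[m] ^+ N).
  rewrite mpolyXn.
  apply: (@initial_ideal_nonmin K _ _ _ _ _ _ ha w (m *+ N)%MM).
  move=> [y [mNy mNmin]].
  have m'y : represents a m' y.
    exists c; rewrite m'E; split=> //.
    rewrite qE -mE; apply: (represents_uniq _ mNy); exists c; split.
      split=> e; rewrite ?ler0n // exponent_neq0 mulmnE muln_eq0 negb_or.
      by move=> /andP[me _]; apply: mc.2; rewrite exponent_neq0.
    congr chart; rewrite /comb scaler_sumr; apply: eq_bigr => e _.
    by rewrite /exponent mulmnE natrM scalerA mulrC.
  have := mNmin _ m'y; rewrite wdegMn leqNgt => /negP[].
  by rewrite /wdeg; under eq_bigr do rewrite mnmE.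
have /(initial_idealP ha)/(_ x) := radJ _ _ XmN.
by rewrite coeff_sumX asboolT // => /eqP; rewrite oner_eq0.
Qed.

Lemma radical_of_min_height :
  (forall m x, min_represents a w m x -> is_height a w x (wdeg w m)%:R) ->
  radical_ideal J.
Proof.
move=> height g k /(initial_idealP ha) gk0; apply/(initial_idealP ha) => x.
have [[m0 m0x]|no] := pselect (exists m, min_represents a w m x); last first.
  by apply: big1 => m /asboolP mx; case: no; exists m.
have [c [u [Mu Cu Eu]]] := represents_cone ha m0x.1.
(* By hypothesis the lift of [m0] is the lowest point over [x], so it lies in a face [F] of the
   bottom. *)
have low := height _ _ m0x; rewrite -Eu in low.
move/(is_heightE _ _ _ Cu): low => low.
have [m0c m0E] := represents_at m0x.1 Cu Eu.
have [F [fF Fb Fu]] := lowest_face low.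
have [z zE] := int_coord a c.
pose T e := `[< pts c (val (a e)) /\ F (at_height (coord a c e) (w e)%:R) >].
have combE m : coeffs_on a c (exponent m) ->
    comb a c (exponent m) = map_mx intr (degree_in z m).
  move=> [_ mc]; rewrite /degree_in raddf_sum; apply: eq_bigr => e _.
  rewrite raddfMn /= -scaler_nat /exponent.
  have [->|me] := eqVneq (m e) 0%N; first by rewrite !scale0r.
  by rewrite zE // ; apply: mc; rewrite exponent_neq0.
have TP m : supported_in T m <-> coeffs_on a c (exponent m) /\
    F (at_height (comb a c (exponent m)) (wdeg w m)%:R).
  split=> [/forallP mT|[mc Fm]].
    have mc : coeffs_on a c (exponent m).
      apply: coeffs_on_exponent => e me.
      by have := mT e; rewrite me => /asboolP[].
    split=> //; rewrite -wt_exponent; apply/(face_lift_of fF mc) => e.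
    by rewrite exponent_neq0 => me; have := mT e; rewrite me => /asboolP[].
  apply/forallP => e; apply/implyP => me; apply/asboolP.
  have me' : exponent m e != 0 :> R by rewrite exponent_neq0.
  split; first exact: mc.2.
  by apply: (face_lift_of fF mc).1 me'; rewrite wt_exponent.
(* Monomials supported on [F] have the height as weight and so are minimal. Conversely, a minimal
   representative of the point of [m] has the weight of [m], hence the same lift in [F]. *)
have sumE m f : supported_in T m ->
    coeff_sum (in_degree T z (degree_in z m)) f =
    coeff_sum (fun q =>
      `[< min_represents a w q (chart c (comb a c (exponent m))) >]) f.
  move=> /TP[mc Fm]; apply: eq_bigl => q.
  have Cm := cone_comb mc; have lowm := face_lowest Fb Fm.
  apply/andP/asboolP => [[/TP[qc Fq] /eqP qm]|[qm qmin]].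
    have qmE : comb a c (exponent q) = comb a c (exponent m).
      by rewrite !combE // qm.
    split; first by exists c; rewrite qmE.
    move=> q' /lowest_le_wdeg/(_ erefl Cm) le; rewrite -(ler_nat R); apply: le.
    by rewrite -qmE; apply: face_lowest Fq.
  have [qc qE] := represents_at qm Cm erefl.
  have wqm : wdeg w q = wdeg w m.
    apply/eqP; rewrite eqn_leq qmin ?andTb; last by exists c.
    by rewrite -(ler_nat R); apply: lowest_le_wdeg qm erefl Cm lowm.
  split; first by apply/TP; rewrite qE wqm.
  apply/eqP/rowP => j; move: qE; rewrite !combE // => /rowP/(_ j).
  by rewrite !mxE => /intr_inj.
have m0T : supported_in T m0 by apply/TP; rewrite m0E.
rewrite -Eu -m0E -sumE //; apply: (coeff_sum_nilpotent (k := k)) => v.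
(* A degree not attained on [F] gives an empty sum; an attained one belongs to a point at which the
   sum for [g ^+ k] vanishes. *)
have [[m mv]|no] := pselect (exists m, in_degree T z v m); last first.
  by apply: big1 => m mv; case: no; exists m.
have /andP[mT /eqP <-] := mv.
by rewrite sumE.
Qed.

End Radical.

Theorem corollary3p5 (K : fieldType) (R : realType) (X : choiceType)
    (S : conicalComplex R X) (M : monoidalComplex S)
    (n : nat) (a : 'I_n -> monsupp M) (ha : generating_family a)
    (w : 'I_n -> nat) :
  radical_ideal (initial_ideal w (toric_ideal K a)) <->
  (forall d : set X, Gamma_facet a w d ->
   forall c : face S, smallest_face d c ->
     N_monoid a w c d = mon M c `&` (cone c `&` chart c @^-1` d)).
Proof.
rewrite (normality_iff_min_height ha w).
split; [exact: min_height_of_radical|exact: radical_of_min_height].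
Qed.
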